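(* Let $\nu>0$, $T>0$, let $\mathcal X=\Pi^d$ be the torus, and assume that the interaction kernel satisfies $K\in L^\infty$. Let $(\bar\rho_t)_{t\in[0,T]}$ solve $\partial_t\bar\rho_t+\operatorname{div}\big(\bar\rho_t(-\nabla V+K*\bar\rho_t)\big)=\nu\Delta\bar\rho_t$ with initial probability density $\bar\rho_0$, and let $(\rho^f_t)_{t\in[0,T]}$ solve $\partial_t\rho^f_t+\operatorname{div}(\rho^f_tf_t)=0$, $\rho^f_0=\bar\rho_0$, for a velocity field $f=f(t,x)$ of class $C^1$ in $(t,x)$. Then $$\sup_{t\in[0,T]}\mathbf{KL}(\rho^f_t,\bar\rho_t)\le\frac1\nu\exp\Big(\frac{2\|K\|_{L^\infty}^2}{\nu}T\Big)R(f),$$ where $$R(f)=\int_0^T\int_{\mathcal X}\big|f(t,x)+\nabla V(x)-K*\rho^f_t(x)+\nu\nabla\log\rho^f_t(x)\big|^2\,d\rho^f_t(x)\,dt .$$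
   Context: $\Pi^d$ is the torus, i.e. the cube $[-L,L]^d$ with periodic boundary conditions. $V$ is a given potential and $K$ takes values in $\mathbb R^d$. Convolution is $h*\phi(x)=\int_{\mathcal X}h(x-y)\phi(y)\,dy$. Differential operators act in the spatial variable only. $\mathbf{KL}(\rho,\bar\rho)=\int_{\mathcal X}\rho\log\frac{\rho}{\bar\rho}$. The velocity field is $f:[0,T]\times\mathcal X\to\mathbb R^d$, $f_t(\cdot)=f(t,\cdot)$. Solutions are classical. *)

(* Defs.v *)
From HB Require Import structures.
From mathcomp Require Import all_boot all_order all_algebra.
From mathcomp Require Import all_classical all_reals all_analysis.

Set Implicit Arguments.
Unset Strict Implicit.
Unset Printing Implicit Defensive.

Import Order.TTheory GRing.Theory Num.Theory.
Import numFieldNormedType.Exports.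

Local Open Scope classical_set_scope.
Local Open Scope ring_scope.

(* Functions on the torus [-L, L]^d are the functions on R^d that are
   2L-periodic in each coordinate.  R^d is 'rV[R]_d for topology and
   differentiation, and d.-tuple R for measurability and integration; the two
   are identified by [rowt]. *)

Section side_measure.
Context {R : realType}.
Variable L : R.

Definition side_measure : set (measurableTypeR R) -> \bar R :=
  mrestr (@lebesgue_measure R) (measurable_itv `[- L, L]).

HB.instance Definition _ := Measure.on side_measure.

Let side_measure_finite : fin_num_fun side_measure.
Proof.
move=> A mA; rewrite ge0_fin_numE ?measure_ge0//.
apply: (@le_lt_trans _ _ (@lebesgue_measure R `[- L, L]%classic)).
  apply: le_measure; rewrite ?inE.
  - by apply: measurableI => //; exact: measurable_itv.
  - exact: measurable_itv.
  - exact: subIsetr.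
by rewrite lebesgue_measure_itv; case: ifP => _ //=; rewrite -EFinB ltry.
Qed.

HB.instance Definition _ :=
  Measure_isFinite.Build _ _ _ side_measure side_measure_finite.

End side_measure.

Section cons_measure.
Context {R : realType}.
Variables (L : R) (n : nat).
Variable m : {finite_measure set (n.-tuple (measurableTypeR R)) -> \bar R}.

Let cons_pair (p : measurableTypeR R * n.-tuple (measurableTypeR R)) :
  n.+1.-tuple (measurableTypeR R) := [the n.+1.-tuple _ of p.1 :: p.2].

Let measurable_cons_pair : measurable_fun setT cons_pair.
Proof. by apply: measurable_cons. Qed.

Definition cons_measure : set (n.+1.-tuple (measurableTypeR R)) -> \bar R :=
  pushforward (side_measure L \x m)%E cons_pair.

Let cons_measure0 : cons_measure set0 = 0%E.
Proof. exact: measure0. Qed.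

Let cons_measure_ge0 A : (0 <= cons_measure A)%E.
Proof. exact: measure_ge0. Qed.

Let cons_measure_sigma_additive : semi_sigma_additive cons_measure.
Proof. exact: measure_semi_sigma_additive. Qed.

HB.instance Definition _ := isMeasure.Build _ _ _ cons_measure
  cons_measure0 cons_measure_ge0 cons_measure_sigma_additive.

Let cons_measure_finite : fin_num_fun cons_measure.
Proof.
move=> A mA; rewrite ge0_fin_numE ?measure_ge0//.
apply: (@le_lt_trans _ _ (cons_measure setT)).
  by apply: le_measure; rewrite ?inE.
rewrite /cons_measure /pushforward preimage_setT -setXTT product_measure1E//.
by rewrite lte_mul_pinfty// ?fin_num_measure// -ge0_fin_numE ?fin_num_measure.
Qed.

HB.instance Definition _ :=
  Measure_isFinite.Build _ _ _ cons_measure cons_measure_finite.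

End cons_measure.

(* Lebesgue measure on the cube [-L, L]^d, as an iterated product *)
Fixpoint torus_measure {R : realType} (L : R) (d : nat) :
    {finite_measure set (d.-tuple (measurableTypeR R)) -> \bar R} :=
  match d with
  | 0 => \d_([tuple] : 0.-tuple (measurableTypeR R))
  | n.+1 => cons_measure L (torus_measure L n)
  end.

Section torus.
Context {R : realType} {d : nat}.
Implicit Types (L T nu : R) (h phi rho V : 'rV[R]_d -> R)
  (K F : 'rV[R]_d -> 'rV[R]_d) (u : R -> 'rV[R]_d -> R)
  (f : R -> 'rV[R]_d -> 'rV[R]_d).

Definition rowt (x : d.-tuple (measurableTypeR R)) : 'rV[R]_d :=
  \row_i (tnth x i : R).

Definition torus_fun (U : zmodType) L (g : 'rV[R]_d -> U) : Prop :=
  forall i : 'I_d, periodic g ((2 * L) *: 'e_i).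

(* the library's norm on 'rV[R]_d is the sup norm *)
Definition enorm (v : 'rV[R]_d) : R := Num.sqrt (\sum_i v ord0 i ^+ 2).

Definition partial (i : 'I_d) h : 'rV[R]_d -> R := fun x => 'D_('e_i) h x.

Definition grad h : 'rV[R]_d -> 'rV[R]_d := fun x => \row_i partial i h x.

Definition divergence F : 'rV[R]_d -> R :=
  fun x => \sum_i partial i (fun y => F y ord0 i) x.

Definition laplacian h : 'rV[R]_d -> R :=
  fun x => \sum_i partial i (partial i h) x.

Definition convolution L K phi : 'rV[R]_d -> 'rV[R]_d := fun x =>
  \row_i (\int[torus_measure L d]_y
            (K (x - rowt y) ord0 i * phi (rowt y)))%R.

Definition ptime u : R -> 'rV[R]_d -> R := fun t x => derive1 (u ^~ x) t.

Definition class_C1 h : Prop := forall i,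
  (forall x, derivable h x 'e_i) /\ continuous (partial i h).

Definition class_C2 h : Prop :=
  class_C1 h /\ forall i, class_C1 (partial i h).

Definition slab_continuous T u : Prop :=
  {within `[0, T]%classic `*` setT,
    continuous (fun p : R * 'rV[R]_d => u p.1 p.2)}.

(* [w], used only on ]0, T[ x R^d, has a continuous extension to
   [0, T] x R^d *)
Definition slab_extends T (w : R -> 'rV[R]_d -> R) : Prop :=
  exists2 G, slab_continuous T G &
    forall t x, t \in `]0, T[ -> G t x = w t x.

(* C^1([0, T] x R^d): the first derivatives exist on the open slab and extend
   continuously to the closed one *)
Definition slab_C1 T u : Prop :=
  [/\ slab_continuous T u,
      forall t x, t \in `]0, T[ -> derivable (u ^~ x) t 1,
      slab_extends T (ptime u) &
      forall i, (forall t x, t \in `]0, T[ -> derivable (u t) x 'e_i) /\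
                slab_extends T (fun t => partial i (u t))].

(* C^{1,2}([0, T] x R^d): once in time, twice in space *)
Definition slab_C12 T u : Prop :=
  slab_C1 T u /\
  forall i j,
    (forall t x, t \in `]0, T[ -> derivable (partial i (u t)) x 'e_j) /\
    slab_extends T (fun t => partial j (partial i (u t))).

Definition Linfty_enorm L K : \bar R :=
  Lnorm (torus_measure L d) +oo%E (fun x => (enorm (K (rowt x)))%:E).

Definition is_Linfty L K : Prop :=
  (forall i, measurable_fun setT
     (fun x : d.-tuple (measurableTypeR R) =>
        (K (rowt x) ord0 i : measurableTypeR R))) /\
  (Linfty_enorm L K < +oo)%E.

Definition Linfty_norm L K : R :=
  fine (Linfty_enorm L K).

Definition is_prob_density L rho : Prop :=
  (forall x, 0 <= rho x) /\
  (\int[torus_measure L d]_x (rho (rowt x))%:E = 1)%E.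

Definition mckean_vlasov_solution nu L T V K u : Prop :=
  [/\ forall t, t \in `[0, T] -> torus_fun L (u t),
      slab_C12 T u &
      forall t x, t \in `]0, T[ ->
        ptime u t x
        + divergence (fun y => u t y *: (- grad V y + convolution L K (u t) y)) x
        = nu * laplacian (u t) x].

Definition continuity_solution L T f u : Prop :=
  [/\ forall t, t \in `[0, T] -> torus_fun L (u t),
      slab_C1 T u &
      forall t x, t \in `]0, T[ ->
        ptime u t x + divergence (fun y => u t y *: f t y) x = 0].

Definition class_C1_velocity L T f : Prop :=
  (forall t, t \in `[0, T] -> torus_fun L (f t)) /\
  forall i, slab_C1 T (fun t x => f t x ord0 i).

(* a log (a / b), with 0 log (0 / b) = 0 and a log (a / 0) = +oo for a != 0 *)
Definition kl_integrand (a b : R) : \bar R :=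
  if a == 0 then 0%E else if b == 0 then +oo%E else (a * ln (a / b))%:E.

Definition KL L (rho rho' : 'rV[R]_d -> R) : \bar R :=
  (\int[torus_measure L d]_x kl_integrand (rho (rowt x)) (rho' (rowt x)))%E.

(* The weight u t kills the points where u t = 0, at which the gradient of
   log (u t) has no meaning.  The value may be +oo. *)
Definition residual nu L T V K f u : \bar R :=
  (\int[@lebesgue_measure R]_(t in `[0%R, T])
     \int[torus_measure L d]_x
       (enorm (f t (rowt x) + grad V (rowt x) - convolution L K (u t) (rowt x)
               + nu *: grad (fun y => ln (u t y)) (rowt x)) ^+ 2
        * u t (rowt x))%:E)%E.

End torus.

(* Main.v *)
Require Import Defs.
From HB Require Import structures.
From mathcomp Require Import all_boot all_order all_algebra.
From mathcomp Require Import all_classical all_reals all_analysis.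
From mathcomp Require Import measurable_realfun ess_sup_inf ring lra.

Set Implicit Arguments.
Unset Strict Implicit.
Unset Printing Implicit Defensive.

Import Order.TTheory GRing.Theory Num.Theory.
Import numFieldNormedType.Exports.

Local Open Scope classical_set_scope.
Local Open Scope ring_scope.

(** The proof differentiates the relative entropy in time.  Write p for the
    density carried by the velocity f, q for the McKean-Vlasov density and
    b = - grad V + K * q for the drift of the latter, so that q is carried by
    the velocity b - nu grad log q.  With g = grad log (p / q), formally
      d/dt KL(p, q) = int p g . (f - b + nu grad log q).
    Let delta = f + grad V - K * p + nu grad log p be the residual field and
    c = K * (p - q).  Then f - b + nu grad log q = delta + c - nu g, and
    Young's inequality absorbs g into the dissipation - nu |g|^2:
      d/dt KL <= nu^-1 int p |delta|^2 + (2 nu)^-1 int p |c|^2.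
    Finally |c| <= |K|_oo |p - q|_1, and the Hellinger lower bound of the
    entropy gives |p - q|_1^2 <= 4 KL; the last term is at most
    2 |K|_oo^2 / nu * KL and Gronwall's lemma yields the stated constants.

    To make this rigorous one has to face four points.

    Zeros of the densities.  Nothing prevents p and q from vanishing, where
    the logarithms are singular.  The computation is done for P = p + eps and
    Q = q + eps and for the pointwise nonnegative integrand
    P log (P / Q) - P + Q ([rel_ent]).  The shift does not satisfy the
    equations exactly: it produces the extra field eps (P - Q) / Q b, which
    [rel_ent_error] bounds by a small multiple eta of the entropy plus
    eps exp (1 + 1 / eta).  The first part disturbs the Gronwall rate, the
    second is a source ([ent_production_le], [ent_rate_le], [ent_bound]).
    Letting eta tend to 0, with eps so small that eps exp (1 + 1 / eta) = eta,
    Fatou's lemma recovers KL ([rel_ent_cvg], [fatou_cvg_le], [KL_le_fin]).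
    At a zero of p its gradient vanishes as well, since p is minimal there, so
    these points carry neither flux nor residual.

    Sign and mass.  The equations alone have to provide p, q >= 0, by a
    minimum principle ([minimum_principle], [transport_nonneg]), and the
    conservation of mass ([mass_conserved]).

    Rough kernel.  K is only bounded, so K * phi is differentiated by moving
    translations onto phi ([kconv_shift], [kconv_is_derive]).  This uses the
    invariance of the torus measure under the maps y |-> c - y
    ([integral_torus_refl]), which also gives the vanishing of the integral of
    a divergence ([torus_int_divergence]).

    Measurability.  The density of the residual involves grad log p and need
    not be known to be measurable.  The integral of a nonnegative function is
    a supremum over simple functions, hence monotone for arbitrary functions
    ([ge0_le_lower_integral]); the Gronwall argument
    ([increment_le_integral], [gronwall]) is arranged to use only this. *)

(** * Reflections and translations of the torus measure *)
Section refl.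
Context {R : realType}.
Implicit Types (c : R) (g : measurableTypeR R -> \bar R).
Notation mu := (@lebesgue_measure R).

Let refl c : measurableTypeR R -> measurableTypeR R := fun y => c - y.

Lemma measurable_refl c : measurable_fun setT (refl c).
Proof. exact: measurable_funB. Qed.

Lemma lebesgue_measure_refl c A : measurable A ->
  pushforward mu (refl c) A = mu A.
Proof.
have mr := measurable_refl c.
move=> mA; apply/esym.
apply: (lebesgue_measure_unique (mu := measure_function_pushforward__canonical__measure_function_Measure mu mr)) => //.
move=> X [[a b] _ <-] /=.
rewrite lebesgue_measure_itv/= /pushforward.
have -> : refl c @^-1` `]a, b]%classic = `[c - b, c - a[%classic.
  by apply/seteqP; split => x /=; rewrite !in_itv/= /refl; lra.
rewrite lebesgue_measure_itv/= !lte_fin ltrD2l ltrN2.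
by case: ifP => // _; rewrite -!EFinB; congr EFin; lra.
Qed.

Lemma ge0_integral_refl c (D : set R) g : measurable D -> measurable_fun setT g ->
  (forall y, 0 <= g y)%E ->
  (\int[mu]_(y in refl c @^-1` D) g (c - y)%R = \int[mu]_(y in D) g y)%E.
Proof.
move=> mD mg g0; rewrite -(ge0_integral_pushforward (measurable_refl c)) //.
- apply: eq_measure_integral => [|? A mA _]; first exact: measurable_refl.
  exact: lebesgue_measure_refl.
- exact: measurable_funTS.
Qed.

Lemma ge0_integral_shift c (a b : R) g : measurable_fun setT g ->
  (forall y, 0 <= g y)%E ->
  (\int[mu]_(y in `[a, b[) g (y + c)%R = \int[mu]_(y in `[(a + c)%R, (b + c)%R[) g y)%E.
Proof.
move=> mg g0.
have mg' : measurable_fun setT (fun y : measurableTypeR R => g (c - y)%R).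
  by apply: measurableT_comp => //; exact: (measurable_refl c).
have E : forall u v, refl c @^-1` `]u, v]%classic = `[c - v, c - u[%classic.
  by move=> u v; apply/seteqP; split => x /=; rewrite !in_itv/= /refl; lra.
have E' : forall u v, refl c @^-1` `[u, v[%classic = `]c - v, c - u]%classic.
  by move=> u v; apply/seteqP; split => x /=; rewrite !in_itv/= /refl; lra.
have := @ge0_integral_refl c `[a + c, b + c[%classic g (measurable_itv _) mg g0.
rewrite E' => <-.
have := @ge0_integral_refl 0 `]c - (b + c), c - (a + c)]%classic _ (measurable_itv _) mg' (fun y => g0 _).
have -> : refl 0 @^-1` `]c - (b + c), c - (a + c)]%classic = `[a, b[%classic.
  by apply/seteqP; split => x /=; rewrite !in_itv/= /refl; lra.
move=> <-; apply: eq_integral => y _; congr g; lra.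
Qed.

(** The integral of a periodic function is the same over every window of one
    period: move the window by whole periods until it meets [-L, L[, then swap
    the part that sticks out. *)
Lemma integral_period (L : R) c g : 0 < L -> measurable_fun setT g ->
  (forall y, 0 <= g y)%E -> (forall y, g (y + 2 * L)%R = g y) ->
  (\int[mu]_(y in `[c, (c + 2 * L)%R[) g y = \int[mu]_(y in `[(- L)%R, L[) g y)%E.
Proof.
move=> L0 mg g0 gper.
have gperN k y : g (y + 2 * L * k%:R) = g y.
  elim: k y => [|k IH] y; first by rewrite mulr0 addr0.
  by rewrite -[RHS]IH -[RHS]gper -(natr1 k) mulrDr mulr1 addrA.
have gperz (k : int) y : g (y + 2 * L * k%:~R) = g y.
  case: k => k; first exact: gperN.
  by rewrite NegzE mulrNz mulrN -[LHS](gperN k.+1) subrK.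
have spl a : - L <= a <= L ->
    (\int[mu]_(y in `[a, (a + 2 * L)%R[) g y = \int[mu]_(y in `[(- L)%R, L[) g y)%E.
  move=> aL.
  have U1 : `[a, a + 2 * L[%classic = `[a, L[%classic `|` `[L, a + 2 * L[%classic.
    by apply/seteqP; split => x /=; rewrite !in_itv/=; [|case]; lra.
  have U2 : `[- L, L[%classic = `[-L, a[%classic `|` `[a, L[%classic.
    by apply/seteqP; split => x /=; rewrite !in_itv/=; [|case]; lra.
  rewrite U1 U2 !ge0_integral_setU//; first last.
  - apply/disj_setPS => x /=; rewrite !in_itv/= => -[]; lra.
  - exact: measurable_funTS.
  - apply/disj_setPS => x /=; rewrite !in_itv/= => -[]; lra.
  - exact: measurable_funTS.
  rewrite addeC; congr (_ + _)%E.
  have := @ge0_integral_shift (2 * L) (- L) a g mg g0.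
  have -> : - L + 2 * L = L by lra.
  by move=> <-; apply: eq_integral => y _; exact: gper.
pose k := Num.floor ((c + L) / (2 * L)).
have L20 : 0 < 2 * L by lra.
have /andP[k1 k2] : (k%:~R <= (c + L) / (2 * L) < (k + 1)%:~R).
  by rewrite floor_itv// num_real.
move: k1 k2; rewrite ler_pdivlMr// ltr_pdivrMr// intrD => k1 k2.
have := @spl (c - 2 * L * k%:~R); rewrite (mulrC _ k%:~R) => <-; last by lra.
have := @ge0_integral_shift (k%:~R * (2 * L)) (c - k%:~R * (2 * L)) (c - k%:~R * (2 * L) + 2 * L) g mg g0.
rewrite subrK addrAC subrK => <-.
by apply: eq_integral => y _; rewrite (mulrC _ (2 * L)) gperz.
Qed.

Lemma integral_side (L : R) g : measurable_fun setT g ->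
  (forall y, 0 <= g y)%E ->
  (\int[side_measure L]_y g y = \int[mu]_(y in `[(- L)%R, L[) g y)%E.
Proof.
move=> mg g0; rewrite integral_itv_bndo_bndc; last exact: measurable_funTS.
rewrite (@ge0_negligible_integral _ _ _ (side_measure L) setT (~` `[- L, L]%classic))//; last 2 first.
- exact: measurableC.
- by rewrite /= /side_measure /mrestr/= setICl measure0.
rewrite setDE setCK setTI; apply: eq_measure_integral => A mA AL.
by rewrite /= /side_measure /mrestr/= (setIidl AL).
Qed.

Lemma integral_side_refl (L : R) c g : 0 < L -> measurable_fun setT g ->
  (forall y, 0 <= g y)%E -> (forall y, g (y + 2 * L)%R = g y) ->
  (\int[side_measure L]_y g (c - y)%R = \int[side_measure L]_y g y)%E.
Proof.
move=> L0 mg g0 gper.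
have mg' : measurable_fun setT (fun y : measurableTypeR R => g (c - y)%R).
  by apply: measurableT_comp => //; exact: (measurable_refl c).
rewrite !integral_side// -(@integral_period L (c - L))//.
rewrite integral_itv_bndo_bndc; last exact: measurable_funTS.
rewrite [RHS]integral_itv_bndo_bndc; last exact: measurable_funTS.
rewrite -(@ge0_integral_refl c _ g)//.
  congr (integral _ _ _); apply/seteqP; split => x /=; rewrite !in_itv/= /refl; lra.
by move=> y; rewrite -[LHS]gper; congr g; lra.
Qed.
End refl.

(** The map y |-> c - y, rather than a translation, is taken as the basic
    symmetry: it is what a convolution needs, and two reflections make a
    translation. *)
Section torus_refl.
Context {R : realType}.
Variable L : R.
Hypothesis L0 : 0 < L.
Notation RM := (measurableTypeR R).

Definition tuple_sub n (c y : n.-tuple RM) : n.-tuple RM :=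
  [tuple (tnth c i : R) - (tnth y i : R) | i < n].

Definition tuple_shift n (i : 'I_n) (y : n.-tuple RM) : n.-tuple RM :=
  [tuple (tnth y j : R) + (2 * L) *+ (j == i) | j < n].

Lemma measurable_tuple_sub n (c : n.-tuple RM) : measurable_fun setT (tuple_sub c).
Proof.
apply/measurable_fun_tnthP => i /=.
rewrite (_ : _ \o _ = fun y : n.-tuple RM => (tnth c i : R) - (tnth y i : R)); last first.
  by apply/funext => y /=; rewrite tnth_mktuple.
by apply: measurable_funB => //; exact: measurable_tnth.
Qed.

(** Equality criterion used to compare [tuple_sub] and [tuple_shift] with the
    head-tail decomposition along which the torus measure is defined. *)
Lemma cons_tupleE n (x : RM) (y : n.-tuple RM) (z : n.+1.-tuple RM) :
  x = tnth z ord0 -> (forall i, tnth y i = tnth z (lift ord0 i)) ->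
  [tuple of x :: y] = z.
Proof.
move=> x0 yi; apply: eq_from_tnth => i.
by case: (unliftP ord0 i) => [j ->|->]; rewrite ?tnthS ?yi ?x0.
Qed.

Lemma measurable_cons1 n (x : RM) :
  measurable_fun setT (fun y : n.-tuple RM => [tuple of x :: y]).
Proof. exact: (@measurable_cons _ _ _ _ (cst x) n id). Qed.

Lemma measurable_cons2 n (y : n.-tuple RM) :
  measurable_fun setT (fun x : RM => [tuple of x :: y]).
Proof. exact: (@measurable_cons _ _ _ _ id n (cst y)). Qed.

Section cons.
Variables (n : nat) (g : n.+1.-tuple RM -> \bar R).
Hypotheses (mg : measurable_fun setT g) (g0 : forall y, (0 <= g y)%E).

Let mgp : measurable_fun setT (fun p : RM * n.-tuple RM => g [tuple of p.1 :: p.2]).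
Proof. apply: measurableT_comp => //; exact: measurable_cons. Qed.

Let integral_prod : (\int[torus_measure L n.+1]_y g y =
  \int[side_measure L \x torus_measure L n]_p g [tuple of p.1 :: p.2])%E.
Proof.
rewrite /= -[RHS](@ge0_integral_pushforward _ _ _ _ _ (fun p : RM * n.-tuple RM => [tuple of p.1 :: p.2])
  _ (side_measure L \x torus_measure L n)%E setT g) //.
exact: measurable_cons.
Qed.

Lemma integral_cons1 : (\int[torus_measure L n.+1]_y g y =
  \int[side_measure L]_x \int[torus_measure L n]_y g [tuple of x :: y])%E.
Proof. by rewrite integral_prod (fubini_tonelli1 _ mgp). Qed.

Lemma integral_cons2 : (\int[torus_measure L n.+1]_y g y =
  \int[torus_measure L n]_y \int[side_measure L]_x g [tuple of x :: y])%E.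
Proof. by rewrite integral_prod (fubini_tonelli2 _ mgp). Qed.
End cons.

(** Reflect the tail by induction with the head fixed, then the head with the
    tail fixed: Tonelli lets either variable be integrated first. *)
Lemma ge0_integral_torus_refl n (c : n.-tuple RM) (g : n.-tuple RM -> \bar R) :
  measurable_fun setT g -> (forall y, 0 <= g y)%E ->
  (forall i y, g (tuple_shift i y) = g y) ->
  (\int[torus_measure L n]_y g (tuple_sub c y) = \int[torus_measure L n]_y g y)%E.
Proof.
elim: n c g => [|n IH] c g mg g0 gper.
  by apply: eq_integral => y _; congr g; rewrite (tuple0 y) [LHS]tuple0.
have mgc : measurable_fun setT (fun y => g (tuple_sub c y)).
  by apply: measurableT_comp => //; exact: measurable_tuple_sub.
pose c0 : R := thead c; pose c' : n.-tuple RM := [tuple of behead c].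
have csub (x : RM) (y : n.-tuple RM) : tuple_sub c [tuple of x :: y] = [tuple of (c0 - x)%R :: tuple_sub c' y].
  apply/esym/cons_tupleE; first by rewrite tnth_mktuple.
  move=> i; rewrite !tnth_mktuple tnthS; congr (_ - _).
  by rewrite tnth_behead; congr tnth; apply/val_inj; rewrite /= inordK// ltnS.
have shift0 (x : RM) (y : n.-tuple RM) : tuple_shift ord0 [tuple of x :: y] = [tuple of (x + 2 * L)%R :: y].
  apply/esym/cons_tupleE; first by rewrite tnth_mktuple.
  by move=> i; rewrite !tnth_mktuple tnthS addr0.
have shiftS i (x : RM) (y : n.-tuple RM) : tuple_shift (lift ord0 i) [tuple of x :: y] = [tuple of x :: tuple_shift i y].
  apply/esym/cons_tupleE; first by rewrite tnth_mktuple addr0.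
  by move=> j; rewrite !tnth_mktuple tnthS (inj_eq lift_inj).
pose h y := g [tuple of (c0 - thead y)%R :: [tuple of behead y]].
have mh : measurable_fun setT h.
  apply: measurableT_comp => //; apply: measurable_cons; last exact: measurable_behead.
  by apply: measurable_funB => //; exact: measurable_tnth.
transitivity (\int[torus_measure L n.+1]_y h y)%E.
  rewrite (integral_cons1 mgc)// (integral_cons1 mh); last by move=> y; exact: g0.
  apply: eq_integral => x _.
  under eq_integral do rewrite csub.
  rewrite (IH c' (fun y => g [tuple of (c0 - x)%R :: y]))//.
  - apply: eq_integral => y _; rewrite /h; congr (g [tuple of _ :: _]).
    exact: val_inj.
  - by apply: measurableT_comp => //; exact: measurable_cons1.
  - by move=> i y; rewrite -shiftS.
rewrite (integral_cons2 mh); last by move=> y; exact: g0.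
rewrite (integral_cons2 mg g0).
apply: eq_integral => y _.
rewrite -[RHS](@integral_side_refl _ _ c0 (fun x => g [tuple of x :: y]))//.
- apply: eq_integral => x _; rewrite /h; congr (g [tuple of _ :: _]).
  exact: val_inj.
- by apply: measurableT_comp => //; exact: measurable_cons2.
- by move=> x; rewrite -shift0.
Qed.

Lemma integral_torus_refl n (c : n.-tuple RM) (g : n.-tuple RM -> \bar R) :
  measurable_fun setT g -> (forall i y, g (tuple_shift i y) = g y) ->
  (\int[torus_measure L n]_y g (tuple_sub c y) = \int[torus_measure L n]_y g y)%E.
Proof.
move=> mg gper; rewrite integralE [RHS]integralE; congr (_ - _)%E.
- apply: (eq_trans _ (@ge0_integral_torus_refl n c (g^\+)%E _ _ _)) => //.
  + by apply: eq_integral => y _; rewrite !(funeposE, funenegE).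
  + exact: measurable_funepos.
  + by move=> i y; rewrite !funeposE gper.
- apply: (eq_trans _ (@ge0_integral_torus_refl n c (g^\-)%E _ _ _)) => //.
  + by apply: eq_integral => y _; rewrite !(funeposE, funenegE).
  + exact: measurable_funeneg.
  + by move=> i y; rewrite !funenegE gper.
Qed.

End torus_refl.

(** * Periodic functions on the torus *)
Section torus_integral.
Context {R : realType} {d : nat}.
Implicit Types (x y : 'rV[R]_d) (g h : 'rV[R]_d -> R).
Notation RM := (measurableTypeR R).

Lemma measurable_coord (i : 'I_d) :
  measurable_fun setT (fun y : d.-tuple RM => (rowt y ord0 i : RM)).
Proof. by under eq_fun do rewrite mxE; exact: measurable_tnth. Qed.

(** The product sigma-algebra of tuples sees the topology of row vectors: an
    open set is the countable union of the balls with rational centres and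
    radii 1 / k that it contains, and a ball of the sup norm is a product of
    intervals. *)
Lemma open_rowt_measurable (U : set 'rV[R]_d) : open U ->
  measurable ((rowt : d.-tuple RM -> _) @^-1` U).
Proof.
move=> oU.
pose c (q : 'rV[rat]_d) : 'rV[R]_d := \row_i ratr (q ord0 i).
pose F (p : 'rV[rat]_d * nat) : set (d.-tuple RM) :=
  [set y | ball (c p.1) p.2.+1%:R^-1 `<=` U /\ ball (c p.1) p.2.+1%:R^-1 (rowt y)].
have -> : (rowt : d.-tuple RM -> _) @^-1` U = \bigcup_p F p.
  apply/seteqP; split=> [y Uy|y [p _ [pU yp]]]; last exact: pU.
  have /nbhs_ballP[e/= e0 eU] : nbhs (rowt y) U by exact: open_nbhs_nbhs.
  have e20 : 0 < e / 2 by rewrite divr_gt0.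
  have [k _ ke] := near_infty_natSinv_lt (PosNum e20).
  have {}ke := ke k (leqnn k).
  have k0 : 0 < k.+1%:R^-1 :> R by rewrite invr_gt0.
  have /choice[q qy] : forall i, exists q, ball (rowt y ord0 i) k.+1%:R^-1 (ratr q).
    move=> i; have /rat_in_itvoo[q] : rowt y ord0 i - k.+1%:R^-1 < rowt y ord0 i + k.+1%:R^-1.
      by rewrite ltrBlDr -addrA ltrDl addr_gt0.
    rewrite in_itv/= => /andP[q1 q2]; exists q; rewrite /ball/=.
    have H (a b r : R) : a - r < b -> b < a + r -> `|a - b| < r.
      by rewrite ltr_norml => ? ?; apply/andP; split; lra.
    exact: H.
  have by_ : ball (c (\row_i q i)) k.+1%:R^-1 (rowt y).
    split => // i j; rewrite ord1 !mxE; apply: ball_sym.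
    by have := qy j; rewrite mxE.
  exists (\row_i q i, k) => //; split => //= z zq; apply: eU.
  have -> : e = e / 2 + e / 2 by lra.
  apply: (@ball_triangle _ _ (c (\row_i q i))).
    by apply: (le_ball (ltW ke)); exact: ball_sym.
  by apply: (le_ball (ltW ke)).
apply: countable_bigcupT_measurable => [|[q k]].
  exact: countableP.
rewrite /F/=; have [qU|qU] := pselect (ball (c q) k.+1%:R^-1 `<=` U); last first.
  by rewrite (_ : [set _ | _] = set0)//; apply/seteqP; split => // y [].
rewrite (_ : [set _ | _] = \bigcap_(i : 'I_d)
  ((fun y : d.-tuple RM => (rowt y ord0 i : RM)) @^-1` ball (c q ord0 i) k.+1%:R^-1)).
  apply: fin_bigcap_measurable; first exact: finite_finset.
  by move=> i _; rewrite -[X in measurable X]setTI; apply: (measurable_coord i) => //; exact: measurable_ball.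
apply/seteqP; split=> [y [_ [_ yq]] i _ /=|y yq]; first exact: yq.
split=> //; split; first by rewrite invr_gt0.
by move=> i j; rewrite ord1; exact: (yq j).
Qed.

Lemma continuous_rowt_measurable g : continuous g ->
  measurable_fun setT (g \o rowt : d.-tuple RM -> RM).
Proof.
move=> cg; apply: (measurability _ (RGenOpens.measurableE R)).
move=> _ [_ [a [b ->]] <-]; rewrite setTI comp_preimage.
apply: open_rowt_measurable; apply: open_comp; last exact: interval_open.
by move=> x _; exact: cg.
Qed.

Variable L : R.
Hypothesis L0 : 0 < L.

Local Notation mu := (torus_measure L d).

Definition torus_measurable g := measurable_fun setT (fun y : d.-tuple RM => g (rowt y) : RM).

Definition trow (c : 'rV[R]_d) : d.-tuple RM := [tuple c ord0 i | i < d].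

Lemma rowt_sub c (y : d.-tuple RM) : rowt (tuple_sub (trow c) y) = c - rowt y.
Proof. by apply/rowP => i; rewrite !mxE !tnth_mktuple. Qed.

Lemma rowt_shift i (y : d.-tuple RM) :
  rowt (tuple_shift L i y) = rowt y + (2 * L) *: 'e_i.
Proof.
apply/rowP => j; rewrite !mxE !tnth_mktuple eqxx /=.
by case: eqP => _; rewrite ?mulr1n ?mulr0n ?mulr1 ?mulr0.
Qed.

Lemma torus_measurable_refl c g : torus_measurable g -> torus_measurable (fun x => g (c - x)).
Proof.
rewrite /torus_measurable => mg; under eq_fun do rewrite -rowt_sub.
apply: (measurableT_comp mg); exact: measurable_tuple_sub.
Qed.

Lemma torus_integral_refl c (g : 'rV[R]_d -> \bar R) :
  measurable_fun setT (fun y : d.-tuple RM => g (rowt y)) ->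
  (forall (i : 'I_d) x, g (x + (2 * L) *: 'e_i) = g x) ->
  (\int[mu]_y g (c - rowt y)%R = \int[mu]_y g (rowt y))%E.
Proof.
move=> mg gper; under eq_integral do rewrite -rowt_sub.
rewrite (integral_torus_refl L0 (trow c) mg)// => i y.
by rewrite rowt_shift gper.
Qed.

Lemma torus_refl c g : torus_measurable g -> torus_fun L g ->
  (\int[mu]_y g (c - rowt y) = \int[mu]_y g (rowt y))%R.
Proof.
move=> mg gper; rewrite /Rintegral; congr fine.
apply: (torus_integral_refl c (g := EFin \o g)); last by move=> i x /=; rewrite gper.
exact/measurable_EFinP.
Qed.

Lemma torus_fun_refl (U : zmodType) c (g : _ -> U) :
  torus_fun L g -> torus_fun L (fun x => g (c - x)).
Proof. by move=> gper i x; rewrite -[LHS](gper i) opprD addrA subrK. Qed.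

Lemma torus_fun_shift (U : zmodType) c (g : _ -> U) :
  torus_fun L g -> torus_fun L (fun x => g (x + c)).
Proof. by move=> gper i x; rewrite addrAC gper. Qed.

Lemma torus_shift c g : torus_measurable g -> torus_fun L g ->
  (\int[mu]_y g (rowt y + c) = \int[mu]_y g (rowt y))%R.
Proof.
move=> mg gper; rewrite -(torus_refl c mg gper).
rewrite -(torus_refl 0 (torus_measurable_refl c mg) (torus_fun_refl c gper)).
by apply: eq_Rintegral => y _; rewrite sub0r opprK addrC.
Qed.

Definition box (a : R) : set 'rV[R]_d := [set x | forall i, x ord0 i \in `[(- a), a]].

Lemma compact_box a : compact (box a).
Proof.
apply: (@rV_compact _ _ (fun=> `[(- a), a]%classic)).
by move=> _; apply: segment_compact.
Qed.

Lemma torus_fun_int (U : zmodType) (g : _ -> U) (k : 'I_d -> int) x :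
  torus_fun L g -> g (x + \row_i (2 * L * (k i)%:~R)) = g x.
Proof.
move=> gper.
have gn i (n : nat) y : g (y + (2 * L * n%:R) *: 'e_i) = g y.
  elim: n y => [|n IH] y; first by rewrite mulr0 scale0r addr0.
  by rewrite -(natr1 n) mulrDr mulr1 scalerDl addrA gper IH.
have gz i (n : int) y : g (y + (2 * L * n%:~R) *: 'e_i) = g y.
  case: n => n; first exact: gn.
  by rewrite NegzE mulrNz mulrN -[LHS](gn i n.+1) scaleNr subrK.
rewrite [X in x + X](_ : _ = \sum_i (2 * L * (k i)%:~R) *: 'e_i); last first.
  rewrite [LHS]row_sum_delta; apply: eq_bigr => i _; by rewrite mxE.
elim/big_ind : _ x => [x|a b ga gb x|i _ x]; first by rewrite addr0.
  by rewrite addrA gb ga.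
exact: gz.
Qed.

Lemma torus_reduce x : exists k : 'I_d -> int,
  box L (x + \row_i (2 * L * (k i)%:~R)).
Proof.
have L0' := L0; have L20 : 0 < 2 * L by lra.
have /choice[k kP] : forall i : 'I_d, exists k : int,
    x ord0 i + 2 * L * k%:~R \in `[(- L), L].
  move=> i; pose k := Num.floor ((x ord0 i + L) / (2 * L)); exists (- k).
  have /andP[k1 k2] : (k%:~R <= (x ord0 i + L) / (2 * L) < (k + 1)%:~R).
    by rewrite floor_itv// num_real.
  move: k1 k2; rewrite ler_pdivlMr// ltr_pdivrMr// intrD => k1 k2.
  rewrite in_itv/= mulrNz; apply/andP; split; nra.
by exists k => // i; rewrite !mxE.
Qed.

(** Periodic functions take all their values on a compact box, which replaces
    the compactness of the torus. *)
Lemma torus_fun_box (U : zmodType) (g : _ -> U) x : torus_fun L g ->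
  exists2 y, box L y & g y = g x.
Proof.
move=> gper; have [k kP] := torus_reduce x.
by exists (x + \row_i (2 * L * (k i)%:~R)) => //; rewrite torus_fun_int.
Qed.

Lemma box0 : box L 0.
Proof. by have L0' := L0; move=> i; rewrite mxE in_itv/=; lra. Qed.

Lemma torus_fun_bounded g : continuous g -> torus_fun L g ->
  exists2 M, 0 <= M & forall x, `|g x| <= M.
Proof.
move=> cg gper.
have [||c _ cM] := @compact_EVT_max _ _ (fun x => `|g x|) (box L) _ (@compact_box L).
- by exists 0; exact: box0.
- apply: continuous_subspaceT => x; apply: continuous_comp; first exact: cg.
  exact: norm_continuous.
exists `|g c| => // x; have [y yb <-] := torus_fun_box x gper.
by apply: cM; rewrite inE.
Qed.

Lemma bounded_torus_integrable g (M : R) : torus_measurable g -> (forall x, `|g x| <= M) ->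
  mu.-integrable setT (EFin \o (fun y : d.-tuple RM => g (rowt y))).
Proof.
move=> mg gM; apply: measurable_bounded_integrable => //.
  by rewrite -ge0_fin_numE// fin_num_measure.
by exists M; split; [exact: num_real|move=> N MN x _ /=; apply: (le_trans (gM _)); exact: ltW].
Qed.

Lemma continuous_torus_integrable g : continuous g -> torus_fun L g ->
  mu.-integrable setT (EFin \o (fun y : d.-tuple RM => g (rowt y))).
Proof.
move=> cg gper; have [M _ gM] := torus_fun_bounded cg gper.
apply: bounded_torus_integrable gM; exact: continuous_rowt_measurable.
Qed.

End torus_integral.

(** * Calculus under the torus integral *)
Section torus_calculus.
Context {R : realType} {d : nat}.
Variable L : R.
Hypothesis L0 : 0 < L.
Implicit Types (x : 'rV[R]_d) (g h : 'rV[R]_d -> R) (u w G : R -> 'rV[R]_d -> R).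
Notation RM := (measurableTypeR R).
Local Notation mu := (torus_measure L d).

Definition torus_int g : R := (\int[mu]_y g (rowt y))%R.

Definition torus_integrable g : Prop :=
  mu.-integrable setT (EFin \o (fun y : d.-tuple RM => g (rowt y))).

Definition jointly_continuous u : Prop :=
  continuous (fun p : R * 'rV[R]_d => u p.1 p.2).

(** Freezing the time at the ends of [0, T] turns a function that is
    continuous on the closed slab into one that is continuous everywhere, for
    which no subspace topology is needed. *)
Definition clamp (T t : R) : R := Num.max 0 (Num.min t T).

Lemma clamp_id T t : t \in `[0, T] -> clamp T t = t.
Proof.
rewrite in_itv/= => /andP[t0 tT]; rewrite /clamp /Num.min /Num.max.
case: (ltP t T) => tT'; case: ltP => //; lra.
Qed.

Lemma clamp_itv T t : 0 <= T -> clamp T t \in `[0, T].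
Proof.
move=> T0; rewrite in_itv/= /clamp /Num.min /Num.max.
by case: (ltP t T) => tT'; case: ltP => ?; apply/andP; split; lra.
Qed.

Lemma clamp_continuous T : continuous (clamp T).
Proof.
move=> t; apply: (@continuous_max R R (cst 0) (fun t => Num.min t T)); first exact: cst_continuous.
by apply: (@continuous_min R R idfun (cst T)) => //; exact: cst_continuous.
Qed.

Lemma continuous_pair (U : topologicalType) (f : U -> R) (g : U -> 'rV[R]_d) z u :
  {for z, continuous f} -> {for z, continuous g} ->
  {for (f z, g z), continuous (fun p : R * 'rV[R]_d => u p.1 p.2)} ->
  {for z, continuous (fun z => u (f z) (g z))}.
Proof.
move=> cf cg cu.
apply: (@continuous2_cvg _ _ _ _ _ _ f g u (f z) (g z)) => //.
Qed.

Lemma jointly_continuous_clamp T u : 0 <= T ->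
  slab_continuous T u -> jointly_continuous (fun t x => u (clamp T t) x).
Proof.
move=> T0 /subspace_continuousP cu p W /= Wp.
have /cu/(_ W Wp) : (`[0, T]%classic `*` setT) (clamp T p.1, p.2).
  by split => //=; exact: clamp_itv.
rewrite /nbhs/= /within/= => nW.
have cp : (clamp T q.1, q.2) @[q --> p] --> (clamp T p.1, p.2).
  apply: (@cvg_pair _ _ _ _ (nbhs (clamp T p.1)) (nbhs p.2)); last exact: cvg_snd.
  by apply: continuous_comp; [exact: cvg_fst|exact: clamp_continuous].
apply: (@filterS _ (nbhs p) _ _ _ _ (cp _ nW)) => q /=; apply.
by split => //=; exact: clamp_itv.
Qed.

Lemma jointly_continuousW u t : jointly_continuous u -> continuous (u t).
Proof.
move=> cu x; apply: (@continuous_pair _ (cst t) id) => //; first exact: cst_continuous.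
exact: cu.
Qed.

Lemma jointly_continuousT u x : jointly_continuous u -> continuous (u ^~ x).
Proof.
move=> cu t; apply: (@continuous_pair _ id (cst x)) => //; first exact: cst_continuous.
exact: cu.
Qed.

Lemma jointly_continuous_bounded a b u : jointly_continuous u ->
  (forall t, t \in `]a, b[ -> torus_fun L (u t)) ->
  exists2 M : R, 0 <= M & forall t x, t \in `]a, b[ -> `|u t x| <= M.
Proof.
move=> cu per; have [ab|ba] := ltP a b; last first.
  by exists 0 => // t x; rewrite in_itv/= => ?; exfalso; lra.
have [|||c _ cM] := @compact_EVT_max _ _ (fun p : R * 'rV[R]_d => `|u p.1 p.2|) (`[a, b]%classic `*` box L).
- by exists (a, 0); split; [rewrite /= in_itv/= lexx ltW|exact: box0].
- by apply: compact_setX; [exact: segment_compact|exact: compact_box].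
- apply: continuous_subspaceT => x; apply: continuous_comp; first exact: cu.
  exact: norm_continuous.
exists `|u c.1 c.2| => // t x tab; have [y yb <-] := torus_fun_box L0 x (per t tab).
apply: (cM (t, y)); rewrite inE; split => //=; exact: subset_itv_oo_cc.
Qed.

Section parametric.
Variables (k : 'rV[R]_d -> R) (a b : R).
Hypothesis ik : torus_integrable k.

Let mk : torus_measurable k.
Proof. by have /integrableP[/measurable_EFinP] := ik. Qed.

Lemma integrable_weight g : torus_measurable g -> (exists2 M : R, 0 <= M & forall x, `|g x| <= M) ->
  torus_integrable (fun y => k y * g y).
Proof.
move=> mg [M _ gM]; rewrite /torus_integrable.
rewrite (_ : _ \o _ = (fun y : d.-tuple RM => (k (rowt y))%:E) \* (EFin \o (fun y : d.-tuple RM => g (rowt y))))%E//.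
apply: integrableMl => //.
by exists M; split; [exact: num_real|move=> N MN x _ /=; apply: (le_trans (gM _)); exact: ltW].
Qed.

Lemma integrable_norm_weight (M : R) :
  mu.-integrable setT (EFin \o (fun y : d.-tuple RM => M * `|k (rowt y)|)).
Proof.
have H := @integrableZl _ _ _ mu setT measurableT M _ (integrable_abse ik).
by apply: eq_integrable H => // y _.
Qed.

(** The fixed weight k, merely integrable, is there for convolutions; plain
    integrals are the case k = 1. *)
Lemma torus_int_continuous u : jointly_continuous u ->
  (forall t, t \in `]a, b[ -> torus_fun L (u t)) ->
  {in `]a, b[, continuous (fun t => torus_int (fun y => k y * u t y))}.
Proof.
move=> cu per; have [M M0 uM] := jointly_continuous_bounded cu per.
have := @continuity_under_integral R _ _ mu (fun t (y : d.-tuple RM) => k (rowt y) * u t (rowt y)) setT measurableT a b.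
move=> /(_ _ _ (fun y : d.-tuple RM => M * `|k (rowt y)|) _ _) H t tab.
apply: H; last by rewrite inE.
- move=> s sab; apply: integrable_weight.
    apply: continuous_rowt_measurable; exact: jointly_continuousW.
  by exists M => // x; exact: uM.
- apply: aeW => y _ s _; apply: cvgM; [exact: cvg_cst|exact: (jointly_continuousT cu)].
- exact: integrable_norm_weight.
- move=> s sab; apply: aeW => y _; rewrite normrM mulrC ler_wpM2r//; exact: uM.
Qed.

Lemma torus_int_is_derive w G :
  (forall t, t \in `]a, b[ -> continuous (w t) /\ torus_fun L (w t)) ->
  (forall t x, t \in `]a, b[ -> is_derive t 1 (w ^~ x) (G t x)) ->
  jointly_continuous G -> (forall t, t \in `]a, b[ -> torus_fun L (G t)) ->
  forall t, t \in `]a, b[ ->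
  is_derive t 1 (fun t => torus_int (fun y => k y * w t y)) (torus_int (fun y => k y * G t y)).
Proof.
move=> wP wG cG Gper t tab.
have [M M0 GM] := jointly_continuous_bounded cG Gper.
pose f t (y : d.-tuple RM) := k (rowt y) * w t (rowt y).
have df s (y : d.-tuple RM) : `]a, b[%classic s -> is_derive s 1 (f ^~ y) (k (rowt y) * G s (rowt y)).
  by move=> sab; have := wG s (rowt y) sab => ?; rewrite /f; apply: is_deriveZ.
have intf s : `]a, b[%classic s -> mu.-integrable setT (EFin \o f s).
  move=> sab; apply: integrable_weight.
    by apply: continuous_rowt_measurable; have [] := wP s sab.
  by apply: (torus_fun_bounded L0); have [] := wP s sab.
have intG : mu.-integrable setT (EFin \o (fun y : d.-tuple RM => M * `|k (rowt y)|)).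
  exact: integrable_norm_weight.
have d1 s (y : d.-tuple RM) : `]a, b[%classic s -> partial1of2 f s y = k (rowt y) * G s (rowt y).
  by move=> sab; rewrite partial1of2E; have [_ ->] := df s y sab.
have H1 s y : `]a, b[%classic s -> setT y -> derivable (f ^~ y) s 1.
  by move=> sab _; have [] := df s y sab.
have H2 y : 0 <= M * `|k (rowt (y : d.-tuple RM))| by rewrite mulr_ge0.
have H3 s y : `]a, b[%classic s -> setT y -> `|partial1of2 f s y| <= M * `|k (rowt (y : d.-tuple RM))|.
  move=> sab _; rewrite d1// normrM mulrC ler_wpM2r//; exact: GM.
have D := @derivable_under_integral R _ _ mu f setT measurableT t a b tab intf H1 _ H2 intG H3.
apply: DeriveDef; first exact: D.
rewrite -derive1E.
rewrite (@differentiation_under_integral R _ _ mu f setT measurableT t a b tab intf H1 _ H2 intG H3).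
by apply: eq_Rintegral => y _; rewrite /= d1.
Qed.
End parametric.

Lemma continuous_addr (h : 'rV[R]_d) : continuous (fun x : 'rV[R]_d => x + h).
Proof. by move=> x; apply: continuousD; [exact: cvg_id|exact: cst_continuous]. Qed.

Lemma line_growth g x v (t : R) :
  (fun h : R => h^-1 *: (((fun s => g (x + s *: v)) \o shift t) (h *: 1) - g (x + t *: v))) =
  (fun h : R => h^-1 *: ((g \o shift (x + t *: v)) (h *: v) - g (x + t *: v))).
Proof.
apply/funext => h /=; congr (_ *: (g _ - _)).
have -> : h *: (1 : R) = h by exact: mulr1.
by rewrite scalerDl addrCA.
Qed.

(** Directional derivatives are derivatives of one real variable along the
    line, which brings in the one-dimensional calculus. *)
Lemma is_derive_line g x v (t dg : R) :
  is_derive (x + t *: v) v g dg <-> is_derive t 1 (fun s => g (x + s *: v)) dg.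
Proof.
split=> -[dh de]; split.
- by rewrite /derivable line_growth.
- by rewrite -de /derive line_growth.
- by move: dh; rewrite /derivable line_growth.
- by move: de; rewrite /derive line_growth.
Qed.

Lemma is_derive_line0 g x v (dg : R) :
  is_derive x v g dg <-> is_derive (0 : R) 1 (fun s => g (x + s *: v)) dg.
Proof. by rewrite -is_derive_line scale0r addr0. Qed.

Lemma torus_fun_partial i g : torus_fun L g -> torus_fun L (partial i g).
Proof.
move=> gper j x; rewrite /partial /derive; apply: (congr1 (fun q : R -> R => lim (q @ 0^'))).
by apply/funext => h /=; rewrite addrA !gper.
Qed.

Definition torus_cont g := continuous g /\ torus_fun L g.

Lemma torus_cont_integrable g : torus_cont g -> torus_integrable g.
Proof. by move=> [? ?]; exact: continuous_torus_integrable. Qed.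

Lemma torus_cont_measurable g : torus_cont g -> torus_measurable g.
Proof. by move=> [? _]; exact: continuous_rowt_measurable. Qed.

Lemma torus_cont_cst c : torus_cont (cst c).
Proof. by split; [exact: cst_continuous|]. Qed.

Lemma torus_contD g h : torus_cont g -> torus_cont h -> torus_cont (fun x => g x + h x).
Proof.
move=> [cg pg] [ch ph]; split; last by move=> i x; rewrite pg ph.
by move=> x; apply: continuousD; [exact: cg|exact: ch].
Qed.

Lemma torus_contM g h : torus_cont g -> torus_cont h -> torus_cont (fun x => g x * h x).
Proof.
move=> [cg pg] [ch ph]; split; last by move=> i x; rewrite pg ph.
by move=> x; apply: continuousM; [exact: cg|exact: ch].
Qed.

Lemma torus_contN g : torus_cont g -> torus_cont (fun x => - g x).
Proof.
move=> [cg pg]; split; last by move=> i x; rewrite pg.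
by move=> x; apply: continuousN; exact: cg.
Qed.

Lemma torus_contB g h : torus_cont g -> torus_cont h -> torus_cont (fun x => g x - h x).
Proof. by move=> cg /torus_contN; exact: torus_contD. Qed.

Lemma torus_cont_comp (f : R -> R) g : (forall x, {for g x, continuous f}) -> torus_cont g ->
  torus_cont (fun x => f (g x)).
Proof.
move=> cf [cg pg]; split; last by move=> i x; rewrite pg.
by move=> x; apply: continuous_comp; [exact: cg|exact: cf].
Qed.

Lemma torus_cont_sum (I : Type) (s : seq I) (F : I -> 'rV[R]_d -> R) :
  (forall i, torus_cont (F i)) -> torus_cont (fun x => \sum_(i <- s) F i x).
Proof.
move=> cF; elim: s => [|i s IH].
  under eq_fun do rewrite big_nil; exact: torus_cont_cst.
by under eq_fun do rewrite big_cons; exact: torus_contD.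
Qed.

Lemma torus_intD g h : torus_integrable g -> torus_integrable h ->
  torus_int (fun x => g x + h x) = torus_int g + torus_int h.
Proof. by move=> ig ih; rewrite /torus_int RintegralD. Qed.

Lemma torus_intB g h : torus_integrable g -> torus_integrable h ->
  torus_int (fun x => g x - h x) = torus_int g - torus_int h.
Proof. by move=> ig ih; rewrite /torus_int RintegralB. Qed.

Lemma torus_intZ c g : torus_integrable g ->
  torus_int (fun x => c * g x) = c * torus_int g.
Proof. by move=> ig; rewrite /torus_int RintegralZl. Qed.

Lemma le_torus_int g h : torus_integrable g -> torus_integrable h ->
  (forall x, g x <= h x) -> torus_int g <= torus_int h.
Proof. by move=> ig ih gh; apply: le_Rintegral. Qed.

Lemma torus_int_norm g : torus_integrable g -> `|torus_int g| <= torus_int (fun x => `|g x|).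
Proof. by move=> ig; apply: le_normr_Rintegral. Qed.

Lemma torus_int_sum (I : Type) (s : seq I) (F : I -> 'rV[R]_d -> R) :
  (forall i, torus_cont (F i)) ->
  torus_int (fun x => \sum_(i <- s) F i x) = \sum_(i <- s) torus_int (F i).
Proof.
move=> cF; elim: s => [|i s IH].
  under eq_fun do rewrite big_nil.
  by rewrite big_nil /torus_int Rintegral_cst// mul0r.
under eq_fun do rewrite big_cons.
rewrite big_cons torus_intD ?IH//; apply: torus_cont_integrable => //.
exact: torus_cont_sum.
Qed.

(** By translation invariance the integral of x |-> g (x + h e_i) does not
    depend on h; differentiate it at h = 0. *)
Lemma torus_int_partial i g : torus_cont g -> (forall x, derivable g x 'e_i) ->
  continuous (partial i g) -> torus_int (partial i g) = 0.
Proof.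
move=> [cg gper] dg cdg.
pose w (h : R) x := g (x + h *: 'e_i); pose G (h : R) x := partial i g (x + h *: 'e_i).
have cadd := @continuous_addr.
have i1 : torus_integrable (cst 1) by apply: torus_cont_integrable; exact: torus_cont_cst.
have := @torus_int_is_derive (cst 1) (-1) 1 i1 w G _ _ _ _ 0.
have w1 : (fun t => torus_int (fun y => cst 1 y * w t y)) = cst (torus_int g).
  apply/funext => t; rewrite /torus_int -(torus_shift L0 (t *: 'e_i) (g := g))//.
    by apply: eq_Rintegral => y _; rewrite mul1r.
  exact: continuous_rowt_measurable.
rewrite w1.
have -> : torus_int (fun y => cst 1 y * G 0 y) = torus_int (partial i g).
  by congr torus_int; apply/funext => x; rewrite mul1r /G scale0r addr0.
move=> H.
have [] := H.
- move=> t _; split; last exact: torus_fun_shift.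
  by move=> x; apply: continuous_comp; [exact: cadd|exact: cg].
- by move=> t x _; apply/is_derive_line; apply: DeriveDef.
- move=> p; apply: continuous_comp; last exact: cdg.
  by apply: cvgD; [exact: cvg_snd|apply: cvgZr_tmp; exact: cvg_fst].
- by move=> t _; apply: torus_fun_shift; exact: torus_fun_partial.
- by rewrite in_itv/= ltrN10 ltr01.
- by move=> _; rewrite derive_cst => <-.
Qed.

Lemma torus_int_divergence (F : 'I_d -> 'rV[R]_d -> R) :
  (forall i, torus_cont (F i)) -> (forall i x, derivable (F i) x 'e_i) ->
  (forall i, continuous (partial i (F i))) ->
  torus_int (fun x => \sum_i partial i (F i) x) = 0.
Proof.
move=> cF dF cdF; rewrite torus_int_sum.
  by rewrite big1// => i _; exact: torus_int_partial.
by move=> i; split => //; apply: torus_fun_partial; case: (cF i).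
Qed.

(** * Convolution with an integrable kernel *)
Section convolution.
Variable k : 'rV[R]_d -> R.
Hypotheses (ik : torus_integrable k) (kper : torus_fun L k).

Let mk : torus_measurable k.
Proof. by have /integrableP[/measurable_EFinP] := ik. Qed.

Definition kconv (phi : 'rV[R]_d -> R) x := torus_int (fun y => k (x - y) * phi y).

Lemma torus_integrable_refl x : torus_integrable (fun y => k (x - y)).
Proof.
have /integrableP[_ H] := ik; apply/integrableP; split.
  by apply/measurable_EFinP; exact: torus_measurable_refl.
rewrite (torus_integral_refl L0 x (g := fun y => (`|(k y)%:E|)%E))//.
- by apply: measurableT_comp => //; exact/measurable_EFinP.
- by move=> i y; rewrite kper.
Qed.

Lemma torus_int_norm_refl x : torus_int (fun y => `|k (x - y)|) = torus_int (fun y => `|k y|).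
Proof.
apply: (torus_refl L0 x (g := fun y => `|k y|)).
  by apply: measurableT_comp => //; exact: measurable_normr.
by move=> i y; rewrite kper.
Qed.

(** The kernel has no regularity: a translation of the argument is transferred
    to phi. *)
Lemma kconv_shift phi x (h : 'rV[R]_d) : torus_cont phi ->
  kconv phi (x + h) = torus_int (fun y => k (x - y) * phi (y + h)).
Proof.
move=> cphi; have [_ phiper] := cphi.
rewrite /kconv /torus_int -(torus_shift L0 h (g := fun y => k (x + h - y) * phi y)).
- by apply: eq_Rintegral => y _; rewrite (addrC (rowt y)) opprD addrA addrK.
- apply: measurable_funM; last exact: torus_cont_measurable.
  exact: (torus_measurable_refl _ mk).
- by move=> i y; rewrite phiper (torus_fun_refl _ kper).
Qed.

Lemma kconv_integrable phi x : torus_cont phi -> torus_integrable (fun y => k (x - y) * phi y).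
Proof.
move=> [cphi phiper]; apply: (@integrable_weight (fun y => k (x - y))); first exact: torus_integrable_refl.
  exact: continuous_rowt_measurable.
exact: (torus_fun_bounded L0 cphi phiper).
Qed.

Lemma kconv_le phi x M : torus_cont phi -> (forall y, `|phi y| <= M) ->
  `|kconv phi x| <= M * torus_int (fun y => `|k y|).
Proof.
move=> cphi phiM; apply: le_trans (torus_int_norm (kconv_integrable x cphi)) _.
have in_ : torus_integrable (fun y => `|k (x - y)|).
  by apply: (integrable_norm (f := fun y => k (x - rowt y))); exact: torus_integrable_refl.
rewrite -(torus_int_norm_refl x) -torus_intZ//; apply: le_torus_int.
- exact: (integrable_norm (f := fun y => k (x - rowt y) * phi (rowt y)) (kconv_integrable x cphi)).
- by have := integrableZl measurableT M in_; apply: eq_integrable.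
- by move=> y; rewrite normrM mulrC ler_wpM2r.
Qed.

Lemma kconvB phi psi x : torus_cont phi -> torus_cont psi ->
  kconv (fun y => phi y - psi y) x = kconv phi x - kconv psi x.
Proof.
move=> cphi cpsi; rewrite /kconv -torus_intB; try exact: kconv_integrable.
by congr torus_int; apply/funext => y; rewrite mulrBr.
Qed.

Lemma kconv_torus_fun phi : torus_fun L (kconv phi).
Proof.
move=> i x; congr torus_int; apply/funext => y; congr (_ * _).
by rewrite addrAC kper.
Qed.

(** By [kconv_shift] the increment of the convolution is the convolution with
    an increment of phi, and phi is uniformly continuous because it is
    continuous and periodic. *)
Lemma kconv_continuous phi : torus_cont phi -> continuous (kconv phi).
Proof.
move=> cphi x; have [phic phiper] := cphi.
set I := torus_int (fun y => `|k y|).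
have I0 : 0 <= I by apply: Rintegral_ge0.
apply/(@cvgrPdist_le R R _ (nbhs x)) => e e0.
have e'0 : 0 < e / (I + 1) by rewrite divr_gt0// ltr_wpDl.
have : \forall h \near (0 : 'rV[R]_d), box L `<=` (fun y => `|phi y - phi (y + h)| <= e / (I + 1)).
  have /compact_near_coveringP H := @compact_box R d L.
  apply: (H _ (nbhs (0 : 'rV[R]_d)) (fun (z : 'rV[R]_d) y => `|phi y - phi (y + z)| <= e / (I + 1))) => y _.
  have c1 : phi z.1 @[z --> (y, 0 : 'rV[R]_d)] --> phi y.
    by apply: continuous_comp; [exact: cvg_fst|exact: phic].
  have c2 : phi (z.1 + z.2) @[z --> (y, 0 : 'rV[R]_d)] --> phi y.
    rewrite -[in X in _ --> X](addr0 y); apply: (@continuous_comp _ _ _ (fun z : 'rV[R]_d * 'rV[R]_d => z.1 + z.2) phi (y, 0)); last exact: phic.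
    by apply: cvgD; [exact: cvg_fst|exact: cvg_snd].
  have c3 : phi z.1 - phi (z.1 + z.2) @[z --> (y, 0 : 'rV[R]_d)] --> phi y - phi y by exact: cvgB.
  have := (@cvgrPdist_le R R _ (nbhs (y, 0 : 'rV[R]_d)) _ _ _).1 c3 _ e'0.
  move=> /(_ (nbhs_filter _)); rewrite subrr.
  apply: (@filterS _ (nbhs (y, 0 : 'rV[R]_d))) => -[z1 z2] /=.
  by rewrite sub0r normrN.
move=> H; have : \forall h \near (0 : 'rV[R]_d), forall y, `|phi y - phi (y + h)| <= e / (I + 1).
  apply: filterS H => h hb y.
  have per : torus_fun L (fun y => `|phi y - phi (y + h)|).
    by move=> i z; rewrite addrAC !phiper.
  by have [z zb <-] := torus_fun_box L0 y per; exact: hb.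
have cz : z - x @[z --> (x : 'rV[R]_d)] --> (0 : 'rV[R]_d).
  by have := @continuous_addr (- (x : 'rV[R]_d)) x; rewrite /continuous_at subrr.
move=> /cz; apply: (@filterS _ (nbhs x)) => z /= zP.
have -> : z = x + (z - x) by rewrite addrC subrK.
have cs : torus_cont (fun y => phi (y + (z - x))).
  split; last exact: torus_fun_shift.
  by move=> y; apply: continuous_comp; [exact: continuous_addr|exact: phic].
rewrite kconv_shift//.
have := kconv_le x (torus_contB cphi cs) zP.
rewrite kconvB// => /le_trans; apply.
by rewrite mulrAC ler_pdivrMr ?ltr_wpDl// ler_wpM2l ?lerDl// ltW.
Qed.

Lemma kconv_is_derive i phi x : torus_cont phi -> (forall x, derivable phi x 'e_i) ->
  continuous (partial i phi) ->
  is_derive x 'e_i (kconv phi) (kconv (partial i phi) x).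
Proof.
move=> cphi dphi cdphi; have [phic phiper] := cphi; apply/is_derive_line0.
have cadd := @continuous_addr.
have -> : (fun s : R => kconv phi (x + s *: 'e_i)) =
    (fun s => torus_int (fun y => k (x - y) * phi (y + s *: 'e_i))).
  by apply/funext => s; rewrite kconv_shift.
have -> : kconv (partial i phi) x =
    torus_int (fun y => k (x - y) * partial i phi (y + 0 *: 'e_i)).
  by congr torus_int; apply/funext => y; rewrite scale0r addr0.
apply: (@torus_int_is_derive (fun y => k (x - y)) (-1) 1 (torus_integrable_refl x)
  (fun s y => phi (y + s *: 'e_i)) (fun s y => partial i phi (y + s *: 'e_i))).
- move=> t _; split; last exact: torus_fun_shift.
  by move=> y; apply: continuous_comp; [exact: cadd|exact: phic].
- by move=> t y _; apply/is_derive_line; apply: DeriveDef.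
- move=> p; apply: continuous_comp; last exact: cdphi.
  by apply: cvgD; [exact: cvg_snd|apply: cvgZr_tmp; exact: cvg_fst].
- by move=> t _; apply: torus_fun_shift; exact: torus_fun_partial.
- by rewrite in_itv/= ltrN10 ltr01.
Qed.

End convolution.

End torus_calculus.

(** * Scalar inequalities for the relative entropy *)
Section scalar.
Context {R : realType}.
Implicit Types (P Q p : R).

(** Bregman divergence of x log x: unlike P log (P / Q) it is nonnegative at
    every point, and it has the same integral when the masses agree. *)
Definition rel_ent P Q : R := P * (ln P - ln Q) - P + Q.

Lemma ln_le_sub1 (x : R) : 0 < x -> ln x <= x - 1.
Proof. by move=> x0; have := @le_ln1Dx R (x - 1); rewrite [1 + _]addrC subrK; apply; lra. Qed.

(** Apply log x <= x - 1 to the square root of Q / P. *)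
Lemma rel_ent_hellinger P Q : 0 < P -> 0 < Q ->
  (Num.sqrt P - Num.sqrt Q) ^+ 2 <= rel_ent P Q.
Proof.
move=> P0 Q0; set a := Num.sqrt P; set b := Num.sqrt Q.
have a0 : 0 < a by rewrite sqrtr_gt0.
have b0 : 0 < b by rewrite sqrtr_gt0.
have -> : P = a ^+ 2 by rewrite sqr_sqrtr// ltW.
have -> : Q = b ^+ 2 by rewrite sqr_sqrtr// ltW.
rewrite /rel_ent !lnXn//.
have : ln (b / a) <= b / a - 1 by apply: ln_le_sub1; rewrite divr_gt0.
rewrite ln_div ?posrE// => H.
have : a ^+ 2 * (ln b - ln a) <= a ^+ 2 * (b / a - 1) by rewrite ler_wpM2l// sqr_ge0.
have -> : a ^+ 2 * (b / a - 1) = a * b - a ^+ 2 by field; rewrite gt_eqF.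
rewrite !mulr2n; lra.
Qed.

Lemma rel_ent_ge0 P Q : 0 < P -> 0 < Q -> 0 <= rel_ent P Q.
Proof. by move=> P0 Q0; apply: le_trans (rel_ent_hellinger P0 Q0); exact: sqr_ge0. Qed.

(** Factor P - Q through square roots and combine [rel_ent_hellinger] with the
    inequality of arithmetic and geometric means.  Being linear in the entropy,
    the bound can be integrated; optimizing lam afterwards replaces a
    Cauchy-Schwarz inequality for integrals. *)
Lemma rel_ent_diff lam P Q : 0 < lam -> 0 < P -> 0 < Q ->
  `|P - Q| <= lam / 2 * rel_ent P Q + lam^-1 * (P + Q).
Proof.
move=> lam0 P0 Q0; have := rel_ent_hellinger P0 Q0.
set a := Num.sqrt P; set b := Num.sqrt Q; set h := rel_ent P Q => H.
have a0 : 0 < a by rewrite sqrtr_gt0.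
have b0 : 0 < b by rewrite sqrtr_gt0.
have -> : P = a ^+ 2 by rewrite sqr_sqrtr// ltW.
have -> : Q = b ^+ 2 by rewrite sqr_sqrtr// ltW.
have -> : a ^+ 2 - b ^+ 2 = (a - b) * (a + b) by ring.
rewrite normrM (gtr0_norm (addr_gt0 a0 b0)).
rewrite -real_normK ?num_real// in H.
set c := `|a - b| in H *.
have lv0 : 0 < lam^-1 by rewrite invr_gt0.
have lvl : lam * lam^-1 = 1 by rewrite mulfV// gt_eqF.
have H1 : lam / 2 * c ^+ 2 <= lam / 2 * h by rewrite ler_wpM2l// divr_ge0// ltW.
have H2 : 0 <= lam^-1 * (a - b) ^+ 2 by rewrite mulr_ge0 ?sqr_ge0// ltW.
have H3 : 0 <= lam^-1 * (lam * c - (a + b)) ^+ 2 by rewrite mulr_ge0 ?sqr_ge0// ltW.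
have E3 : lam^-1 * (lam * c - (a + b)) ^+ 2 =
  lam * c ^+ 2 - 2 * c * (a + b) + lam^-1 * (a + b) ^+ 2.
  by field; rewrite gt_eqF.
rewrite E3 in H3.
have E4 : lam^-1 * (a - b) ^+ 2 + lam^-1 * (a + b) ^+ 2 = 2 * (lam^-1 * (a ^+ 2 + b ^+ 2)) by ring.
lra.
Qed.

(** Let M = exp (1 + 1 / eta).  Where P >= M Q, the logarithm exceeds
    1 + 1 / eta, so P itself is at most eta times the entropy, while
    eps / Q <= 1 bounds the left side by P.  Elsewhere |P - Q| <= M Q, and one
    factor eps survives. *)
Lemma rel_ent_error eps eta P Q : 0 < eps -> eps <= P -> eps <= Q -> 0 < eta ->
  (eps * (P - Q) / Q) ^+ 2 / P <= eta * rel_ent P Q + eps * expR (1 + eta^-1).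
Proof.
move=> e0 eP eQ eta0.
have P0 : 0 < P by lra.
have Q0 : 0 < Q by lra.
have h0 := rel_ent_ge0 P0 Q0.
set M := expR _.
have M1 : 1 <= M.
  by have := @expR_ge1Dx R (1 + eta^-1); have : 0 < eta^-1 by [rewrite invr_gt0]; rewrite -/M; lra.
have eh0 : 0 <= eta * rel_ent P Q by rewrite mulr_ge0// ltW.
have eM0 : 0 <= eps * M by rewrite mulr_ge0; lra.
have eQ1 : eps / Q <= 1 by rewrite ler_pdivrMr// mul1r.
have eQ0 : 0 <= eps / Q by rewrite divr_ge0; lra.
have [MQ|QM] := leP (M * Q) P.
  have PQ : Q <= P by apply: le_trans MQ; rewrite ler_peMl//; lra.
  have lnPQ : 1 + eta^-1 <= ln P - ln Q.
    rewrite -ln_div ?posrE// -(expRK (1 + eta^-1)) ler_ln ?posrE ?expR_gt0 ?divr_gt0//.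
    by rewrite ler_pdivlMr.
  have hP : P <= eta * rel_ent P Q.
    rewrite mulrC -ler_pdivrMr// /rel_ent.
    have : P * (1 + eta^-1) <= P * (ln P - ln Q) by rewrite ler_wpM2l// ltW.
    lra.
  apply: (@le_trans _ _ P); last lra.
  have y0 : 0 <= eps * (P - Q) / Q by rewrite mulrAC mulr_ge0//; lra.
  have yP : eps * (P - Q) / Q <= P.
    rewrite mulrAC; apply: (@le_trans _ _ (1 * (P - Q))); last lra.
    by rewrite ler_wpM2r//; lra.
  by rewrite ler_pdivrMr// -expr2 ler_sqr ?nnegrE// ltW.
have [QP|PQ] := leP Q P.
  apply: (@le_trans _ _ (eps * M)); last lra.
  rewrite ler_pdivrMr//.
  have -> : (eps * (P - Q) / Q) ^+ 2 = eps * (eps / Q) * ((P - Q) / Q) * (P - Q).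
    by field; rewrite gt_eqF.
  have a1 : (P - Q) / Q <= M by rewrite ler_pdivrMr//; lra.
  have a2 : 0 <= (P - Q) / Q by rewrite divr_ge0; lra.
  have a3 : eps * (eps / Q) <= eps by rewrite ler_piMr// ltW.
  have a4 : 0 <= eps * (eps / Q) by rewrite mulr_ge0// ltW.
  have a5 : eps * (eps / Q) * ((P - Q) / Q) <= eps * M by apply: ler_pM.
  apply: ler_pM => //; try lra.
  by rewrite mulr_ge0.
apply: (@le_trans _ _ eps); last first.
  have : eps * 1 <= eps * M by rewrite ler_wpM2l// ltW.
  lra.
rewrite ler_pdivrMr//.
have -> : (eps * (P - Q) / Q) ^+ 2 = eps ^+ 2 * ((Q - P) / Q) ^+ 2.
  by field; rewrite gt_eqF.
have b1 : (Q - P) / Q <= 1 by rewrite ler_pdivrMr//; lra.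
have b2 : 0 <= (Q - P) / Q by rewrite divr_ge0; lra.
have b3 : ((Q - P) / Q) ^+ 2 <= 1 by rewrite expr_le1.
have : eps ^+ 2 * ((Q - P) / Q) ^+ 2 <= eps ^+ 2 * 1 by rewrite ler_wpM2l// sqr_ge0.
have : eps * eps <= eps * P by rewrite ler_wpM2l// ltW.
rewrite expr2; lra.
Qed.

(** Maximize over g, then split the square of the sum with weights 4, 2, 4,
    which is allowed since 1/4 + 1/2 + 1/4 = 1.  The weight 2 falls on the
    interaction term c, whose constant decides the exponential rate; the
    residual delta can afford a 4. *)
Lemma young3 nu P p g delta c E b : 0 < nu -> 0 < P -> 0 <= p -> p <= P ->
  g * (p * delta + p * c + E * b) - nu * P * g ^+ 2 <=
  nu^-1 * (p * delta ^+ 2) + (2 * nu)^-1 * (p * c ^+ 2) + nu^-1 * (E ^+ 2 / P * b ^+ 2).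
Proof.
move=> nu0 P0 p0 pP.
have nP0 : 0 < nu * P by rewrite mulr_gt0.
set X := p * delta + p * c + E * b.
have H1 : g * X - nu * P * g ^+ 2 <= X ^+ 2 / (4 * (nu * P)).
  rewrite ler_pdivlMr; last by lra.
  have : 0 <= (X - 2 * (nu * P) * g) ^+ 2 by rewrite sqr_ge0.
  by rewrite sqrrB; nra.
apply: (le_trans H1).
have H2 : X ^+ 2 <= 4 * (p * delta) ^+ 2 + 2 * (p * c) ^+ 2 + 4 * (E * b) ^+ 2.
  rewrite /X; move: (p * delta) (p * c) (E * b) => x y z.
  have s1 := sqr_ge0 (2 * x - y); have s2 := sqr_ge0 (y - 2 * z); have s3 := sqr_ge0 (x - z).
  nra.
apply: (@le_trans _ _ ((4 * (p * delta) ^+ 2 + 2 * (p * c) ^+ 2 + 4 * (E * b) ^+ 2) / (4 * (nu * P)))).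
  by rewrite ler_wpM2r// invr_ge0; lra.
have -> : (4 * (p * delta) ^+ 2 + 2 * (p * c) ^+ 2 + 4 * (E * b) ^+ 2) / (4 * (nu * P)) =
  nu^-1 * (p / P * (p * delta ^+ 2)) + (2 * nu)^-1 * (p / P * (p * c ^+ 2)) + nu^-1 * (E ^+ 2 / P * b ^+ 2).
  by field; rewrite !gt_eqF.
have pP1 : p / P <= 1 by rewrite ler_pdivrMr// mul1r.
rewrite !lerD// ler_wpM2l ?invr_ge0//; try lra.
- by rewrite ler_piMl// mulr_ge0// sqr_ge0.
- by rewrite ler_piMl// mulr_ge0// sqr_ge0.
Qed.

End scalar.

(** * Gronwall's inequality with an arbitrary nonnegative bound *)
Section lower_integral.
Context d (X : measurableType d) (R : realType) (mu : {measure set X -> \bar R}).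

(** Both sides are suprema over the nonnegative simple functions below the
    integrand, whether or not the integrand is measurable. *)
Lemma ge0_le_lower_integral (D : set X) (f g : X -> \bar R) :
  (forall x, D x -> 0 <= f x)%E -> (forall x, D x -> f x <= g x)%E ->
  (\int[mu]_(x in D) f x <= \int[mu]_(x in D) g x)%E.
Proof.
move=> f0 fg; rewrite integral_mkcond [leRHS]integral_mkcond.
have f0' x : (0 <= (f \_ D) x)%E by rewrite patchE; case: ifPn => //; rewrite inE => /f0.
have fg' x : ((f \_ D) x <= (g \_ D) x)%E.
  by rewrite !patchE; case: ifPn => //; rewrite inE => /fg.
rewrite ge0_integralTE// ge0_integralTE; last by move=> x; exact: le_trans (fg' x).
apply: ge_ereal_sup => _ [h hf <-]; apply: ereal_sup_ubound; exists h => // x.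
exact: le_trans (hf x) (fg' x).
Qed.

End lower_integral.

Section gronwall.
Context {R : realType}.
Notation mu := (@lebesgue_measure R).

(** On [a, b] inside the open interval the fundamental theorem of calculus
    applies to the continuous function F', which is compared with r through
    its positive part.  Continuity of F at the end points lets a tend to 0
    and b to t. *)
Lemma increment_le_integral (T : R) (F F' : R -> R) (r : R -> \bar R) :
  0 < T -> {within `[0, T], continuous F} ->
  (forall t, t \in `]0, T[ -> is_derive t 1 F (F' t)) ->
  {in `]0, T[, continuous F'} ->
  (forall t, 0 <= r t)%E ->
  (forall t, t \in `]0, T[ -> ((F' t)%:E <= r t)%E) ->
  forall t, t \in `[0, T] -> ((F t - F 0)%:E <= \int[mu]_(s in `[0%R, T]) r s)%E.
Proof.
move=> T0 cF dF cF' r0 F'r t; rewrite in_itv/= => /andP[t0 tT].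
have X0 : (0 <= \int[mu]_(s in `[0%R, T]) r s)%E by exact: integral_ge0.
have step a b : 0 < a -> a < b -> b < T -> ((F b - F a)%:E <= \int[mu]_(s in `[0%R, T]) r s)%E.
  move=> a0 ab bT.
  have abT s : s \in `[a, b] -> s \in `]0, T[.
    by rewrite !in_itv/= => /andP[? ?]; apply/andP; split; lra.
  have cFx s : s \in `[a, b] -> {for s, continuous F}.
    move=> /abT/dF[dFs _]; apply: differentiable_continuous.
    exact/derivable1_diffP.
  have cabF' : {within `[a, b], continuous F'}.
    apply: continuous_in_subspaceT => s; rewrite inE => /abT; exact: cF'.
  have e : (\int[mu]_(s in `[a, b]) (F' s)%:E = (F b)%:E - (F a)%:E)%E.
    apply: continuous_FTC2 => //.
    - split.
      + by move=> s sab; have [] := dF s (abT _ (subset_itv_oo_cc sab)).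
      + apply: cvg_at_right_filter; apply: cFx; rewrite in_itv/= lexx; lra.
      + apply: cvg_at_left_filter; apply: cFx; rewrite in_itv/= lexx andbT; lra.
    - move=> s sab; rewrite derive1E; have := dF s (abT _ (subset_itv_oo_cc sab)).
      by move=> [_ ->].
  rewrite EFinB -e.
  have iF' : mu.-integrable `[a, b] (EFin \o F').
    by apply: continuous_compact_integrable => //; exact: segment_compact.
  apply: (@le_trans _ _ (\int[mu]_(s in `[a, b]) (Num.max 0 (F' s))%:E)%E).
    apply: le_integral => //.
      have -> : (fun s => (Num.max 0 (F' s))%:E) = (fun s => ((EFin \o F')^\+ s)%E).
        by apply/funext => s; rewrite funeposE /= maxC EFin_max.
      exact: integrable_funepos.
    by move=> s _; rewrite lee_fin le_max lexx orbT.
  rewrite integral_mkcond [leRHS]integral_mkcond.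
  apply: ge0_le_lower_integral.
    by move=> s _; rewrite patchE; case: ifP => // _; rewrite lee_fin le_max lexx.
  move=> s _; rewrite !patchE; case: ifPn => [|_]; last by case: ifP.
  rewrite inE/= => sab; have sT := abT _ sab.
  rewrite ifT; last first.
    by rewrite inE/=; exact: subset_itv_oo_cc.
  by rewrite EFin_max ge_max r0 F'r.
move: X0 step; case: (\int[mu]_(s in _) _)%E => [x||]//; rewrite ?leey//.
rewrite !lee_fin => x0 step.
have [->|tn0] := eqVneq t 0; first by rewrite subrr.
have {t0 tn0}t0 : 0 < t by rewrite lt_neqAle eq_sym tn0.
rewrite leNgt; apply/negP => lt_.
pose e := (F t - F 0 - x) / 2.
have e0 : 0 < e by rewrite divr_gt0//; lra.
have cFt : {within `[0, t], continuous F}.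
  by apply: continuous_subspaceW cF => s /=; rewrite !in_itv/=; lra.
have /(continuous_within_itvP _ t0)[_ c0 ct] := cFt.
have n0 : \forall a \near 0^'+, F a < F 0 + e.
  by move/cvgrPdist_lt: c0 => /(_ _ e0); apply: filterS => a; rewrite ltr_norml; lra.
have nt : \forall b \near t^'-, F t - e < F b.
  by move/cvgrPdist_lt: ct => /(_ _ e0); apply: filterS => a; rewrite ltr_norml; lra.
have t20 : 0 < t / 2 by lra.
have [a [a1 a2]] : exists a, (0 < a < t / 2) /\ F a < F 0 + e.
  near (0 : R)^'+ => a; exists a; split; last by near: a.
  by apply/andP; split; near: a; [exact: nbhs_right_gt|exact: nbhs_right_lt].
have t2t : t / 2 < t by lra.
have [b [b1 b2]] : exists b, (t / 2 < b < t) /\ F t - e < F b.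
  near t^'- => b; exists b; split; last by near: b.
  by apply/andP; split; near: b; [exact: nbhs_left_gt|exact: nbhs_left_lt].
have : F b - F a <= x by rewrite -lee_fin; apply: step; lra.
rewrite /e in a2 b2; lra.
Unshelve. all: by end_near. Qed.

(** Multiply by exp (- B s) and integrate.  Where the derivative of the
    weighted function is positive, the factor exp (- B s) <= 1 can be dropped,
    so r is used without a weight. *)
Lemma gronwall (T nu B kap : R) (W W' : R -> R) (r : R -> \bar R) :
  0 < T -> 0 < nu -> 0 <= B -> 0 <= kap ->
  {within `[0, T], continuous W} ->
  (forall t, t \in `]0, T[ -> is_derive t 1 W (W' t)) ->
  {in `]0, T[, continuous W'} ->
  (forall t, 0 <= r t)%E ->
  (forall t, t \in `]0, T[ -> ((nu * (W' t - B * W t - kap))%:E <= r t)%E) ->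
  W 0 = 0 ->
  forall t, t \in `[0, T] ->
  ((nu * W t)%:E <= (expR (B * T))%:E * (\int[mu]_(s in `[0%R, T]) r s + (nu * kap * T)%:E))%E.
Proof.
move=> T0 nu0 B0 kap0 cW dW cW' r0 W'r W0 t tT.
pose F s := nu * (expR (- B * s) * W s - kap * s).
pose F' s := nu * (expR (- B * s) * (W' s - B * W s) - kap).
have dexp (s : R) : is_derive s 1 (fun s => expR (- B * s)) (expR (- B * s) * - B).
  have -> : (fun s => expR (- B * s)) = expR \o (fun s : R => - B * s) by [].
  apply: is_derive1_comp.
  by apply: is_derive_eq; rewrite /GRing.scale/= mulr1.
have dF s : s \in `]0, T[ -> is_derive s 1 F (F' s).
  move=> sT; have ? := dW s sT; have ? := dexp s.
  rewrite /F /F'; apply: is_derive_eq.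
  by rewrite /GRing.scale/= !mulr1; ring.
have cexp : continuous (fun s : R => expR (- B * s)).
  move=> s; have [+ _] := dexp s; move/derivable1_diffP; exact: differentiable_continuous.
have cF : {within `[0, T], continuous F}.
  have c1 : {within `[0, T], continuous (fun s => expR (- B * s) * W s)}.
    by move=> s; apply: cvgM; [exact: (continuous_subspaceT cexp)|exact: cW].
  have c2 : {within `[0, T], continuous (fun s : R => kap * s)}.
    by apply: continuous_subspaceT => z; apply: cvgM; [exact: cvg_cst|exact: cvg_id].
  by move=> s; apply: cvgM; [exact: cvg_cst|apply: cvgB; [exact: c1|exact: c2]].
have cF' : {in `]0, T[, continuous F'}.
  move=> s sT; apply: cvgM; first exact: cvg_cst.
  apply: cvgB; last exact: cvg_cst.
  apply: cvgM; first exact: cexp.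
  apply: cvgB; first exact: cW'.
  apply: cvgM; first exact: cvg_cst.
  have [+ _] := dW s sT; move/derivable1_diffP; exact: differentiable_continuous.
have F'r s : s \in `]0, T[ -> ((F' s)%:E <= r s)%E.
  move=> sT; have [F'0|F'0] := leP (F' s) 0.
    by apply: le_trans (r0 s); rewrite lee_fin.
  apply: le_trans (W'r s sT); rewrite lee_fin /F'.
  have s0 : 0 < s by move: sT; rewrite in_itv/=; lra.
  have e1 : expR (- B * s) <= 1 by rewrite expR_le1; nra.
  have e0 := expR_gt0 (- B * s).
  move: F'0; rewrite /F' pmulr_rgt0// => F'0.
  rewrite ler_wpM2l//; first exact: ltW.
  have : 0 < expR (- B * s) * (W' s - B * W s) by lra.
  rewrite pmulr_rgt0// => H.
  have : expR (- B * s) * (W' s - B * W s) <= W' s - B * W s by rewrite ler_piMl// ltW.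
  lra.
have := increment_le_integral T0 cF dF cF' r0 F'r tT.
have X0 : (0 <= \int[mu]_(s in `[0%R, T]) r s)%E by exact: integral_ge0.
move: X0; case: (\int[mu]_(s in _) _)%E => [x||]//; last first.
  by move=> _ _; rewrite addye// gt0_muley ?leey// lte_fin expR_gt0.
rewrite -EFinD -EFinM !lee_fin => x0.
rewrite /F W0 !mulr0 subr0 mulr0 subr0 => H.
move: tT; rewrite in_itv/= => /andP[t0 tT].
have H2 : nu * (expR (- B * t) * W t) <= x + nu * kap * T.
  have : nu * kap * t <= nu * kap * T by rewrite ler_wpM2l// mulr_ge0// ltW.
  lra.
have ebt : expR (B * t) <= expR (B * T) by rewrite ler_expR ler_wpM2l.
have -> : nu * W t = expR (B * t) * (nu * (expR (- B * t) * W t)).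
  rewrite (_ : expR (B * t) * _ = expR (B * t) * expR (- B * t) * (nu * W t)); last by ring.
  by rewrite mulNr expRxMexpNx_1 mul1r.
have y0 : 0 <= x + nu * kap * T by rewrite addr_ge0// !mulr_ge0// ltW.
apply: (@le_trans _ _ (expR (B * t) * (x + nu * kap * T))).
  by rewrite ler_wpM2l// expR_ge0.
by rewrite ler_wpM2r.
Qed.
End gronwall.

(** * Minimum principle on the torus *)
Section minimum.
Context {R : realType}.

(** One-sided, because the minimum over a time interval may sit at its right
    end. *)
Lemma derive_left_le0 (f : R -> R) (a t D : R) : a < t -> is_derive t 1 f D ->
  (forall s, a < s < t -> f t <= f s) -> D <= 0.
Proof.
move=> at_ [df <-] fmin; rewrite leNgt; apply/negP => D0.
have /(@cvgr_gt _ _ _ _ _ _ df) : 0 < 'D_1 f t by [].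
rewrite near_withinE => /nbhs_ballP[e /= e0 He].
pose h := - Num.min (e / 2) ((t - a) / 2).
have m0 : 0 < Num.min (e / 2) ((t - a) / 2) by rewrite lt_min; lra.
have me : Num.min (e / 2) ((t - a) / 2) <= e / 2 by rewrite ge_min lexx.
have ma : Num.min (e / 2) ((t - a) / 2) <= (t - a) / 2 by rewrite ge_min lexx orbT.
have := He h; rewrite /ball/= sub0r normrN ltr0_norm /h; last lra.
rewrite opprK => /(_ _ _)/= H.
have : f t <= f (h + t) by apply: fmin; rewrite /h; lra.
have := H ltac:(lra) ltac:(lra).
have -> : - Num.min (e / 2) ((t - a) / 2) *: (1 : R) = h by rewrite /GRing.scale/= mulr1.
rewrite -/h [_ *: _]/(_ * _) => H1 H2.
have h0 : h < 0 by rewrite /h; lra.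
have : 0 < h * (h^-1 * (f (h + t) - f t)) * h by rewrite -mulrA nmulr_rgt0// nmulr_llt0.
rewrite mulVKf ?lt_eqF// nmulr_lgt0//; lra.
Qed.

Lemma second_derivative_min (f f' : R -> R) (D : R) :
  (forall s : R, is_derive s 1 f (f' s)) -> is_derive (0 : R) 1 f' D ->
  (forall s, f 0 <= f s) -> 0 <= D.
Proof.
move=> df [df' <-] fmin; rewrite leNgt; apply/negP => D0.
have f'0 : f' 0 = 0.
  have [||||_ E] := @derive1_at_min R f (-1) 1 0.
  - lra.
  - by move=> t _; have [] := df t.
  - by rewrite in_itv/=; lra.
  - by move=> t _.
  by have [_ <-] := df 0; rewrite E.
have /(@cvgr_lt _ _ _ _ _ _ df') : 'D_1 f' 0 < 0 by [].
rewrite near_withinE => /nbhs_ballP[e /= e0 He].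
have neg s : 0 < s < e -> f' s < 0.
  move=> /andP[s0 se]; have := He s; rewrite /ball/= sub0r normrN gtr0_norm// => /(_ se).
  move=> /(_ (lt0r_neq0 s0)); rewrite f'0 subr0 addr0.
  have -> : s%:A = s :> R by exact: mulr1.
  have -> : s^-1 *: f' s = s^-1 * f' s by [].
  by rewrite pmulr_rlt0// invr_gt0.
have e20 : 0 < e / 2 by lra.
have [|c ce E] := @MVT R f f' 0 (e / 2) e20.
  apply: continuous_subspaceT => s; have [+ _] := df s.
  by move/derivable1_diffP; exact: differentiable_continuous.
have c0 : f' c < 0 by apply: neg; move: ce; rewrite in_itv/=; lra.
have := fmin (e / 2); rewrite -subr_ge0 E subr0 pmulr_lge0//; lra.
Qed.

Context {d : nat}.
Variable L : R.
Hypothesis L0 : 0 < L.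

Lemma partial_min (g : 'rV[R]_d -> R) i x : derivable g x 'e_i ->
  (forall y, g x <= g y) -> partial i g x = 0.
Proof.
move=> dg gmin; have /is_derive_line0 H : is_derive x 'e_i g (partial i g x) by exact: DeriveDef.
have Hp : partial i g x <= 0.
  apply: (@derive_left_le0 _ (-1) 0) H _; first lra.
  by move=> s _; rewrite scale0r addr0.
have Hn : - partial i g x <= 0.
  have H' : is_derive x (- 'e_i) g (- partial i g x).
    apply/is_derive_line0; have -> : (fun s => g (x + s *: - 'e_i)) = (fun s => g (x + s *: 'e_i)) \o -%R.
      by apply/funext => s /=; rewrite scalerN scaleNr.
    rewrite -[- partial _ _ _]mulrN1; apply: is_derive1_comp; rewrite oppr0//.
  move/is_derive_line0 in H'.
  apply: (@derive_left_le0 _ (-1) 0) H' _; first lra.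
  by move=> s _; rewrite scale0r addr0.
lra.
Qed.

Lemma partial2_min (g : 'rV[R]_d -> R) i x : (forall y, derivable g y 'e_i) ->
  derivable (partial i g) x 'e_i ->
  (forall y, g x <= g y) -> 0 <= partial i (partial i g) x.
Proof.
move=> dg ddg gmin.
apply: (@second_derivative_min (fun s => g (x + s *: 'e_i)) (fun s => partial i g (x + s *: 'e_i))).
- by move=> s; apply/is_derive_line; exact: DeriveDef.
- by apply/is_derive_line0; exact: DeriveDef.
- by move=> s; rewrite scale0r addr0.
Qed.

(** Suppose u is negative somewhere at a time t1 < T, and take a minimum of
    exp (- lam t) u over [0, t1] and a box of periods.  It is negative, hence
    at a positive time, and is a spatial minimum; there the time derivative of
    exp (- lam t) u is both nonpositive and, by the hypothesis, positive.
    Working below T keeps the minimum where u is differentiable in time; the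
    final time follows by continuity. *)
Lemma minimum_principle (T lam : R) (u : R -> 'rV[R]_d -> R) :
  0 < T -> slab_continuous T u ->
  (forall t, t \in `[0, T] -> torus_fun L (u t)) ->
  (forall x, 0 <= u 0 x) ->
  (forall t x, t \in `]0, T[ -> (forall y, u t x <= u t y) -> u t x < 0 ->
    exists2 D : R, is_derive t 1 (u ^~ x) D & lam * u t x < D) ->
  forall t x, t \in `[0, T] -> 0 <= u t x.
Proof.
move=> T0 cu per u0 H.
have cu' := jointly_continuous_clamp (ltW T0) cu.
pose v (p : R * 'rV[R]_d) := expR (- lam * p.1) * u (clamp T p.1) p.2.
have cv : continuous v.
  move=> p; apply: cvgM; last exact: cu'.
  apply: (@continuous_comp _ _ _ (fun p : R * 'rV[R]_d => - lam * p.1)); last exact: continuous_expR.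
  by apply: cvgM; [exact: cvg_cst|exact: cvg_fst].
have main t1 x : t1 \in `]0, T[ -> 0 <= u t1 x.
  rewrite in_itv/= => /andP[t10 t1T].
  have [|||[t0 x0] + vmin] := @compact_EVT_min _ _ v (`[0, t1]%classic `*` box L).
  - by exists (0, 0); split; [rewrite /= in_itv/= lexx ltW|exact: box0].
  - by apply: compact_setX; [exact: segment_compact|exact: compact_box].
  - exact: continuous_subspaceT.
  rewrite inE/= in_itv/= => -[/andP[t00 t0t1] x0b].
  have cl s : 0 <= s <= t1 -> clamp T s = s.
    by move=> ?; apply: clamp_id; rewrite in_itv/=; lra.
  have vE s y : 0 <= s <= t1 -> v (s, y) = expR (- lam * s) * u s y.
    by move=> st; rewrite /v/= cl.
  have vmin' s y : 0 <= s <= t1 -> v (t0, x0) <= v (s, y).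
    move=> st; have sT : s \in `[0, T] by rewrite in_itv/=; lra.
    have [z zb zy] := torus_fun_box L0 y (per s sT).
    by rewrite vE// -zy -vE//; apply: vmin; rewrite inE; split.
  have [u00|u00] := leP 0 (u t0 x0).
    have : 0 <= v (t1, x).
      by apply: le_trans (vmin' t1 x _); rewrite ?vE ?mulr_ge0 ?expR_ge0//; lra.
    by rewrite vE ?pmulr_rge0 ?expR_gt0//; lra.
  have t00' : 0 < t0.
    by rewrite lt_neqAle t00 andbT; apply/eqP => t0E; move: u00; rewrite -t0E ltNge u0.
  have t0T : t0 \in `]0, T[ by rewrite in_itv/=; lra.
  have xmin y : u t0 x0 <= u t0 y.
    by have := vmin' t0 y; rewrite !vE; [rewrite ler_pM2l ?expR_gt0//; apply|..]; lra.
  have [D dD lD] := H t0 x0 t0T xmin u00.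
  pose w s := expR (- lam * s) * u s x0.
  have dw : is_derive t0 1 w (expR (- lam * t0) * (D - lam * u t0 x0)).
    have dexp : is_derive t0 1 (fun s => expR (- lam * s)) (expR (- lam * t0) * - lam).
      have -> : (fun s => expR (- lam * s)) = expR \o (fun s : R => - lam * s) by [].
      apply: is_derive1_comp.
      by apply: is_derive_eq; rewrite /GRing.scale/= mulr1.
    rewrite /w; apply: is_derive_eq.
    by rewrite /GRing.scale/=; ring.
  have := @derive_left_le0 w 0 t0 _ t00' dw.
  have : 0 < expR (- lam * t0) * (D - lam * u t0 x0).
    by rewrite mulr_gt0 ?expR_gt0//; lra.
  move=> Hpos Hle; suff : expR (- lam * t0) * (D - lam * u t0 x0) <= 0 by lra.
  apply: Hle => s sT; rewrite /w -!vE; try lra.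
  by apply: vmin'; lra.
move=> t x tT.
have cT : {within `[0, T], continuous (u ^~ x)}.
  have cux := jointly_continuousT (x := x) cu'.
  have : {within `[0, T], continuous (fun t => u (clamp T t) x)} by exact: continuous_subspaceT.
  by apply: subspace_eq_continuous => s; rewrite inE => sT; rewrite /from_subspace/= clamp_id.
have /(continuous_within_itvP _ T0)[_ _ cTT] := cT.
move: tT; rewrite in_itv/= => /andP[t0 tT].
have [->|t_neq0] := eqVneq t 0; first exact: u0.
have {t0 t_neq0}t0 : 0 < t by rewrite lt_neqAle eq_sym t_neq0.
have [->|t_neqT] := eqVneq t T; last first.
  by apply: main; rewrite in_itv/= t0 lt_neqAle t_neqT.
apply: (cvgr_to_ge cTT); near=> s; apply: main; rewrite in_itv/=; apply/andP; split => //.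
Unshelve. all: by end_near. Qed.

End minimum.

(** * Convolution with a bounded vector kernel *)
Section kernel.
Context {R : realType} {d : nat}.
Variable L : R.
Hypothesis L0 : 0 < L.
Notation RM := (measurableTypeR R).
Local Notation mu := (torus_measure L d).
Variable K : 'rV[R]_d -> 'rV[R]_d.
Hypotheses (Kper : torus_fun L K) (KL : is_Linfty L K) (mu0 : (0 < mu setT)%E).
Let M := Linfty_norm L K.

Lemma enorm_ge0 (v : 'rV[R]_d) : 0 <= enorm v.
Proof. exact: sqrtr_ge0. Qed.

Lemma sqr_enorm (v : 'rV[R]_d) : enorm v ^+ 2 = \sum_i v ord0 i ^+ 2.
Proof. by rewrite sqr_sqrtr// sumr_ge0// => i _; exact: sqr_ge0. Qed.

Lemma coord_le_enorm (v : 'rV[R]_d) i : `|v ord0 i| <= enorm v.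
Proof.
rewrite -sqrtr_sqr ler_sqrt ?sumr_ge0//; last by move=> j _; exact: sqr_ge0.
by rewrite (bigD1 i)//= lerDl sumr_ge0// => j _; exact: sqr_ge0.
Qed.

Lemma enormZ a (v : 'rV[R]_d) : enorm (a *: v) = `|a| * enorm v.
Proof.
rewrite /enorm -sqrtr_sqr -sqrtrM ?sqr_ge0// mulr_sumr; congr Num.sqrt.
by apply: eq_bigr => i _; rewrite mxE exprMn.
Qed.

Lemma cauchy_schwarz_enorm (v w : 'rV[R]_d) :
  \sum_i v ord0 i * w ord0 i <= enorm v * enorm w.
Proof.
set S := \sum_i _.
have v0 := enorm_ge0 v; have w0 := enorm_ge0 w.
have [wz|wz] := eqVneq (enorm w) 0.
  rewrite wz mulr0 /S big1// => i _.
  suff -> : w ord0 i = 0 by rewrite mulr0.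
  by apply/eqP; rewrite -normr_le0 -wz coord_le_enorm.
have {wz}w0' : 0 < enorm w by rewrite lt_neqAle eq_sym wz.
have : 0 <= \sum_i (enorm w * v ord0 i - (enorm v) * w ord0 i) ^+ 2.
  by apply: sumr_ge0 => i _; exact: sqr_ge0.
have -> : \sum_i (enorm w * v ord0 i - (enorm v) * w ord0 i) ^+ 2 =
   enorm w ^+ 2 * (\sum_i v ord0 i ^+ 2) - 2 * (enorm v * enorm w) * S
   + enorm v ^+ 2 * (\sum_i w ord0 i ^+ 2).
  rewrite /S !mulr_sumr -sumrN -!big_split/=; apply: eq_bigr => i _; ring.
rewrite -!sqr_enorm => H.
have [vz|vz] := eqVneq (enorm v) 0.
  rewrite vz mul0r /S big1// => i _.
  suff -> : v ord0 i = 0 by rewrite mul0r.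
  by apply/eqP; rewrite -normr_le0 -vz coord_le_enorm.
have {vz}v0' : 0 < enorm v by rewrite lt_neqAle eq_sym vz.
have vw0 : 0 < enorm v * enorm w by rewrite mulr_gt0.
rewrite -(ler_pM2l vw0).
have -> : enorm v * enorm w * (enorm v * enorm w) = enorm v ^+ 2 * enorm w ^+ 2 by ring.
have E : enorm w ^+ 2 * enorm v ^+ 2 = enorm v ^+ 2 * enorm w ^+ 2 by ring.
move: H; rewrite E; lra.
Qed.

Lemma Linfty_norm_ge0 : 0 <= M.
Proof. by rewrite /M /Linfty_norm fine_ge0// Lnorm_ge0. Qed.

(** The L^oo norm is an essential supremum only for a nonzero measure, whence
    the hypothesis on mu. *)
Lemma ae_kernel_le : {ae mu, forall y, enorm (K (rowt y)) <= M}.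
Proof.
have [_ fin] := KL.
have E : Linfty_enorm L K = ess_sup mu (abse \o (fun y : d.-tuple RM => (enorm (K (rowt y)))%:E)).
  by rewrite /Linfty_enorm unlock mu0.
have ME : M%:E = Linfty_enorm L K.
  by rewrite /M /Linfty_norm fineK// ge0_fin_numE// Lnorm_ge0.
have := ess_sup_ge mu (abse \o (fun y : d.-tuple RM => (enorm (K (rowt y)))%:E)).
rewrite -E -ME; apply: filterS => y /=.
by rewrite lee_fin ger0_norm// enorm_ge0.
Qed.

(** The part of |K| above its essential supremum.  It vanishes almost
    everywhere, but keeping it in the inequalities makes them hold everywhere,
    so that they survive the substitution z = x - y. *)
Definition kexcess (z : 'rV[R]_d) : R := Num.max 0 (enorm (K z) - M).

Lemma measurable_enorm_kernel : torus_measurable (fun z => enorm (K z)).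
Proof.
have [mK _] := KL.
apply: (@measurableT_comp _ _ _ _ _ _ (@Num.sqrt R)).
  by apply: continuous_measurable_fun; exact: sqrt_continuous.
apply: measurable_sum => i; apply: measurable_funX; exact: mK.
Qed.

Lemma kexcess_ge0 z : 0 <= kexcess z.
Proof. by rewrite /kexcess le_max lexx. Qed.

Lemma measurable_kexcess : torus_measurable kexcess.
Proof.
apply: measurable_maxr => //; apply: measurable_funB => //.
exact: measurable_enorm_kernel.
Qed.

Let int_kexcess : (\int[mu]_y `|(kexcess (rowt y))%:E| = 0)%E.
Proof.
apply/ae_eq_integral_abs => //.
  by apply/measurable_EFinP; exact: measurable_kexcess.
apply: filterS ae_kernel_le => y yM _ /=; congr EFin.
by rewrite /kexcess; apply/max_idPl; rewrite subr_le0.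
Qed.

Lemma kexcess_integrable : torus_integrable L kexcess.
Proof.
apply/integrableP; split; first by apply/measurable_EFinP; exact: measurable_kexcess.
by rewrite /= int_kexcess.
Qed.

Lemma torus_int_kexcess : torus_int L (fun z => `|kexcess z|) = 0.
Proof. by rewrite /torus_int /Rintegral/= -[RHS]/(fine 0%E) -int_kexcess. Qed.

Lemma kexcess_per : torus_fun L kexcess.
Proof. by move=> i z; rewrite /kexcess Kper. Qed.

Lemma enorm_le_kexcess z : enorm (K z) <= M + kexcess z.
Proof. by rewrite -lerBlDl /kexcess le_max lexx orbT. Qed.

Lemma kernel_coord_integrable i : torus_integrable L (fun z => K z ord0 i).
Proof.
have [mK _] := KL.
have iM : torus_integrable L (fun z => M + kexcess z).
  have i1 : @torus_integrable R d L (cst M) by exact: (torus_cont_integrable L0 (torus_cont_cst _ _)).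
  have := integrableD measurableT i1 kexcess_integrable.
  by apply: eq_integrable.
apply: le_integrable iM => //; first by apply/measurable_EFinP; exact: mK.
move=> y _; rewrite /= lee_fin (ger0_norm (x := M + _)); last first.
  by rewrite addr_ge0 ?kexcess_ge0 ?Linfty_norm_ge0.
by rewrite (le_trans (coord_le_enorm _ _))// enorm_le_kexcess.
Qed.

Lemma kernel_coord_per i : torus_fun L (fun z => K z ord0 i).
Proof. by move=> j z; rewrite Kper. Qed.

Lemma convolutionE phi x i :
  convolution L K phi x ord0 i = kconv L (fun z => K z ord0 i) phi x.
Proof. by rewrite mxE. Qed.

(** With c = (K * phi) (x), pair with c itself: |c|^2 is the integral of
    c . K (x - y) phi (y), which Cauchy-Schwarz bounds by |c| times
    the integral of |K (x - y)| |phi (y)|; the excess of |K| over M integrates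
    to 0. *)
Lemma enorm_convolution_le phi x : torus_cont L phi ->
  enorm (convolution L K phi x) <= M * torus_int L (fun y => `|phi y|).
Proof.
move=> cphi; set c := convolution L K phi x.
have c0 := enorm_ge0 c; have M0 := Linfty_norm_ge0.
have ik := kernel_coord_integrable; have kper := kernel_coord_per.
have cphi' : torus_cont L (fun y => `|phi y|).
  by apply: (torus_cont_comp (f := Num.norm)) cphi => z; exact: norm_continuous.
have [Mphi _ phiM] := torus_fun_bounded L0 cphi.1 cphi.2.
have i1 : torus_integrable L (fun y => kexcess (x - y) * `|phi y|).
  by apply: kconv_integrable => //; [exact: kexcess_integrable|exact: kexcess_per].
have i2 : torus_integrable L (fun y => enorm c * (M * `|phi y| + kexcess (x - y) * `|phi y|)).
  have H1 : torus_integrable L (fun y => M * `|phi y|).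
    have := integrableZl measurableT M (torus_cont_integrable L0 cphi').
    by apply: eq_integrable.
  have := integrableZl measurableT (enorm c) (integrableD measurableT H1 i1).
  by apply: eq_integrable.
have z1 : torus_int L (fun y => kexcess (x - y) * `|phi y|) = 0.
  have := @kconv_le R d L L0 kexcess kexcess_integrable kexcess_per (fun y => `|phi y|) x Mphi cphi'.
  rewrite torus_int_kexcess mulr0 => /(_ _) H.
  by apply/eqP; rewrite -normr_le0; apply: H => y; rewrite normr_id.
have isum (s : seq 'I_d) : torus_integrable L (fun y => \sum_(i <- s) c ord0 i * (K (x - y) ord0 i * phi y)) /\
    torus_int L (fun y => \sum_(i <- s) c ord0 i * (K (x - y) ord0 i * phi y)) = \sum_(i <- s) c ord0 i ^+ 2.
  elim: s => [|i s [IH1 IH2]].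
    under [X in torus_integrable _ X]eq_fun do rewrite big_nil.
    under [X in torus_int _ X]eq_fun do rewrite big_nil.
    rewrite big_nil; split; last by rewrite /torus_int Rintegral_cst// mul0r.
    by exact: (torus_cont_integrable L0 (torus_cont_cst _ _)).
  have ii : torus_integrable L (fun y => K (x - y) ord0 i * phi y).
    by apply: (kconv_integrable L0 (ik i) (kper i)).
  have ii' : torus_integrable L (fun y => c ord0 i * (K (x - y) ord0 i * phi y)).
    by have := integrableZl measurableT (c ord0 i) ii; apply: eq_integrable.
  under [X in torus_integrable _ X]eq_fun do rewrite big_cons.
  under [X in torus_int _ X]eq_fun do rewrite big_cons.
  split; first by have := integrableD measurableT ii' IH1; apply: eq_integrable.
  rewrite (torus_intD ii' IH1) IH2 big_cons (torus_intZ _ ii); congr (_ + _).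
  by rewrite {2}/c convolutionE.
have [iL eL] := isum (index_enum 'I_d).
have H : enorm c ^+ 2 <= enorm c * (M * torus_int L (fun y => `|phi y|)).
  rewrite sqr_enorm -eL; apply: le_trans (le_torus_int iL i2 _) _.
    move=> y; have := cauchy_schwarz_enorm c (phi y *: K (x - y)).
    have -> : \sum_i c ord0 i * (phi y *: K (x - y)) ord0 i = \sum_i c ord0 i * (K (x - y) ord0 i * phi y).
      by apply: eq_bigr => i _; congr (_ * _); rewrite mxE mulrC.
    move/le_trans; apply; rewrite ler_wpM2l// enormZ mulrC -mulrDl ler_wpM2r//.
    exact: enorm_le_kexcess.
  have H1 : torus_integrable L (fun y => M * `|phi y|).
    have := integrableZl measurableT M (torus_cont_integrable L0 cphi').
    by apply: eq_integrable.
  have H2 : torus_integrable L (fun y => M * `|phi y| + kexcess (x - y) * `|phi y|).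
    by have := integrableD measurableT H1 i1; apply: eq_integrable.
  rewrite (torus_intZ _ H2) (torus_intD H1 i1) z1 addr0.
  by rewrite (torus_intZ _ (torus_cont_integrable L0 cphi')).
have [->|cn0] := eqVneq (enorm c) 0.
  by rewrite mulr_ge0//; apply: Rintegral_ge0.
by rewrite expr2 ler_pM2l// in H; rewrite lt_neqAle eq_sym cn0.
Qed.

End kernel.

(** * Functions continuously differentiable in one direction *)
Section dirC1.
Context {R : realType} {d : nat}.
Variable L : R.
Hypothesis L0 : 0 < L.
Implicit Types (g h : 'rV[R]_d -> R) (i : 'I_d).

(** Only one direction at a time: a drift component is known to be
    differentiable in each direction separately, and a divergence needs no
    more.  The rules below return the derivative together with its
    regularity. *)
Definition dirC1 i g : Prop :=
  [/\ torus_cont L g, forall x, derivable g x 'e_i & continuous (partial i g)].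

Lemma dirC1_is_derive i g x : dirC1 i g -> is_derive x 'e_i g (partial i g x).
Proof. by case=> _ dg _; apply: DeriveDef. Qed.

Lemma dirC1_partial i g : dirC1 i g -> torus_cont L (partial i g).
Proof. by case=> -[_ per] _ ?; split => //; exact: torus_fun_partial. Qed.

Lemma dirC1_intro i g g' : torus_cont L g -> (forall x, is_derive x 'e_i g (g' x)) ->
  continuous g' -> dirC1 i g /\ partial i g = g'.
Proof.
move=> cg dg cg'; have E : partial i g = g' by apply/funext => x; have [_ <-] := dg x.
by split => //; split; rewrite ?E// => x; have [] := dg x.
Qed.

Lemma dirC1M i g h : dirC1 i g -> dirC1 i h -> dirC1 i (fun x => g x * h x) /\
  partial i (fun x => g x * h x) = (fun x => g x * partial i h x + h x * partial i g x).
Proof.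
move=> Hg Hh; apply: dirC1_intro.
- by apply: torus_contM; [case: Hg|case: Hh].
- move=> x; have ? := dirC1_is_derive x Hg; have ? := dirC1_is_derive x Hh.
  exact: is_deriveM.
- have cg := dirC1_partial Hg; have ch := dirC1_partial Hh.
  case: Hg Hh => g0 _ _ [h0 _ _].
  by have [] := torus_contD (torus_contM g0 ch) (torus_contM h0 cg).
Qed.

Lemma dirC1D i g h : dirC1 i g -> dirC1 i h -> dirC1 i (fun x => g x + h x) /\
  partial i (fun x => g x + h x) = (fun x => partial i g x + partial i h x).
Proof.
move=> Hg Hh; apply: dirC1_intro.
- by apply: torus_contD; [case: Hg|case: Hh].
- move=> x; have ? := dirC1_is_derive x Hg; have ? := dirC1_is_derive x Hh.
  exact: is_deriveD.
- by have [] := torus_contD (dirC1_partial Hg) (dirC1_partial Hh).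
Qed.

Lemma dirC1N i g : dirC1 i g -> dirC1 i (fun x => - g x) /\
  partial i (fun x => - g x) = (fun x => - partial i g x).
Proof.
move=> Hg; apply: dirC1_intro.
- by apply: torus_contN; case: Hg.
- move=> x; have ? := dirC1_is_derive x Hg; exact: is_deriveN.
- by have [] := torus_contN (dirC1_partial Hg).
Qed.

Lemma dirC1_cst i c : dirC1 i (cst c) /\ partial i (cst c : 'rV[R]_d -> R) = cst 0.
Proof.
apply: (@dirC1_intro i (cst c) (cst 0)); first exact: torus_cont_cst.
exact: cst_continuous.
Qed.

Lemma dirC1B i g h : dirC1 i g -> dirC1 i h -> dirC1 i (fun x => g x - h x) /\
  partial i (fun x => g x - h x) = (fun x => partial i g x - partial i h x).
Proof.
by move=> Hg /dirC1N[Hh E]; have [H1 H2] := dirC1D Hg Hh; rewrite H2 E.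
Qed.

Lemma is_derive_compR (f : R -> R) g (x v : 'rV[R]_d) (a b : R) :
  is_derive (g x) 1 f a -> is_derive x v g b -> is_derive x v (fun y => f (g y)) (a * b).
Proof.
move=> df /is_derive_line0 dg; apply/is_derive_line0.
by apply: (@is_derive1_comp _ f (fun s => g (x + s *: v))); rewrite scale0r addr0.
Qed.

Lemma dirC1_comp i (f f' : R -> R) g : dirC1 i g ->
  (forall x, is_derive (g x) 1 f (f' (g x))) -> (forall x, {for g x, continuous f'}) ->
  dirC1 i (fun x => f (g x)) /\
  partial i (fun x => f (g x)) = (fun x => f' (g x) * partial i g x).
Proof.
move=> Hg df cf'; apply: dirC1_intro.
- apply: torus_cont_comp; last by case: Hg.
  by move=> x; have [+ _] := df x; move/derivable1_diffP; exact: differentiable_continuous.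
- by move=> x; apply: is_derive_compR => //; exact: dirC1_is_derive.
- have [] // := torus_contM (_ : torus_cont L (fun x => f' (g x))) (dirC1_partial Hg).
  by apply: torus_cont_comp => //; case: Hg.
Qed.

End dirC1.

(** * Sign and mass of solutions of transport equations *)
Section transport.
Context {R : realType} {d : nat}.
Variable L : R.
Hypothesis L0 : 0 < L.
Variable T : R.
Hypothesis T0 : 0 < T.
Implicit Types (u w : R -> 'rV[R]_d -> R).

Let clampP t : t \in `]0, T[ -> clamp T t = t.
Proof. by move=> tT; apply: clamp_id; exact: subset_itv_oo_cc. Qed.

Let clamp_in t : clamp T t \in `[0, T].
Proof. by apply: clamp_itv; exact: ltW. Qed.

Let i1 : @torus_integrable R d L (cst 1).
Proof. exact: (torus_cont_integrable L0 (torus_cont_cst _ _)). Qed.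

Lemma ptime_per w t : (forall t, t \in `[0, T] -> torus_fun L (w t)) ->
  t \in `]0, T[ -> torus_fun L (ptime w t).
Proof.
move=> wper tT i x; rewrite /ptime !derive1E; apply: near_eq_derive.
have : \forall s \near t, s \in `]0, T[ by exact: near_in_itvoo.
by apply: filterS => s sT; apply: wper; exact: subset_itv_oo_cc.
Qed.

Lemma torus_int_time_derivative w :
  slab_continuous T w -> (forall t, t \in `[0, T] -> torus_fun L (w t)) ->
  (forall t x, t \in `]0, T[ -> derivable (w ^~ x) t 1) ->
  slab_extends T (ptime w) ->
  exists W' : R -> R,
  [/\ {within `[0, T], continuous (fun t => torus_int L (w t))},
      forall t, t \in `]0, T[ -> is_derive t 1 (fun t => torus_int L (w t)) (W' t),
      {in `]0, T[, continuous W'} &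
      forall t, t \in `]0, T[ -> W' t = torus_int L (ptime w t)].
Proof.
move=> cw wper dw [G0 cG0 G0E].
have cw' := jointly_continuous_clamp (ltW T0) cw.
have cG := jointly_continuous_clamp (ltW T0) cG0.
pose G t x := G0 (clamp T t) x.
have GE t : t \in `]0, T[ -> G t = ptime w t.
  by move=> tT; apply/funext => x; rewrite /G clampP// G0E.
have one (u : R -> 'rV[R]_d -> R) : (fun t => torus_int L (fun y => cst 1 y * u t y)) = (fun t => torus_int L (u t)).
  by apply/funext => t; congr torus_int; apply/funext => y; rewrite mul1r.
exists (fun t => torus_int L (G t)); split.
- have := @torus_int_continuous R d L L0 (cst 1) (-1) (T + 1) i1 _ cw'.
  move=> /(_ (fun t _ => wper _ (clamp_in t))); rewrite one => H.
  have : {within `[0, T], continuous (fun t => torus_int L (w (clamp T t)))}.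
    apply: continuous_in_subspaceT => t; rewrite inE/= => tT; apply: H.
    by move: tT; rewrite !in_itv/=; lra.
  by apply: subspace_eq_continuous => t; rewrite inE/= => tT; rewrite /from_subspace/= clamp_id.
- move=> t tT.
  have := @torus_int_is_derive R d L L0 (cst 1) 0 T i1 w G _ _ cG _ t tT.
  rewrite one.
  have -> : torus_int L (fun y => cst 1 y * G t y) = torus_int L (G t).
    by congr torus_int; apply/funext => y; rewrite mul1r.
  apply.
  + move=> s sT; split; last by apply: wper; exact: subset_itv_oo_cc.
    by have := jointly_continuousW (t := s) cw'; rewrite clampP.
  + by move=> s x sT; apply: DeriveDef; [exact: dw|rewrite GE// /ptime derive1E].
  + by move=> s sT; rewrite GE//; exact: ptime_per.
- rewrite -(one G); apply: torus_int_continuous => // t tT.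
  by rewrite GE//; exact: ptime_per.
- by move=> t tT; rewrite GE.
Qed.

(** At a spatial minimum the gradient of u vanishes, so the divergence reduces
    to u div beta.  If moreover u < 0 there, then |div beta| <= C gives
    d/dt u >= C u > (C + 1) u, as [minimum_principle] requires. *)
Lemma transport_nonneg u (beta : R -> 'rV[R]_d -> 'rV[R]_d) (r : R -> 'rV[R]_d -> R) (C : R) :
  slab_C1 T u -> (forall t, t \in `[0, T] -> torus_fun L (u t)) ->
  (forall x, 0 <= u 0 x) ->
  (forall t x, t \in `]0, T[ ->
    ptime u t x + divergence (fun y => u t y *: beta t y) x = r t x) ->
  (forall t x, t \in `]0, T[ -> (forall y, u t x <= u t y) -> 0 <= r t x) ->
  (forall t i x, t \in `]0, T[ -> derivable (fun y => beta t y ord0 i) x 'e_i) ->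
  (forall t x, t \in `]0, T[ -> `|divergence (beta t) x| <= C) ->
  forall t x, t \in `[0, T] -> 0 <= u t x.
Proof.
move=> [cu du _ ux] uper u0 eq r0 dbeta betaC.
apply: (minimum_principle (lam := C + 1) L0 T0 cu uper u0) => t x tT umin ux0.
exists (ptime u t x).
  by apply: DeriveDef; [exact: du|rewrite /ptime derive1E].
have dE : divergence (fun y => u t y *: beta t y) x = u t x * divergence (beta t) x.
  rewrite /divergence mulr_sumr; apply: eq_bigr => i _.
  have -> : (fun y => (u t y *: beta t y) ord0 i) = (fun y => u t y * beta t y ord0 i).
    by apply/funext => y; rewrite mxE.
  have [dux _] := ux i.
  have pm := partial_min (dux t x tT) umin.
  have ? : is_derive x 'e_i (u t) 0 by apply: DeriveDef; [exact: dux|exact: pm].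
  have ? : is_derive x 'e_i (fun y => beta t y ord0 i) (partial i (fun y => beta t y ord0 i) x).
    by apply: DeriveDef => //; exact: dbeta.
  have [_ E] := is_deriveM (f := u t) (g := fun y => beta t y ord0 i) (x := x) (v := 'e_i) _ _.
  by rewrite {1}/partial E /GRing.scale/= mulr0 addr0.
have := eq t x tT; rewrite dE => E.
have H := r0 t x tT umin; have HC := betaC t x tT.
rewrite ler_norml in HC.
have : ptime u t x = r t x - u t x * divergence (beta t) x by rewrite -E addrK.
move=> ->; case/andP: HC => HC1 HC2; nra.
Qed.

Lemma mass_conserved u (J : R -> 'I_d -> 'rV[R]_d -> R) :
  slab_C1 T u -> (forall t, t \in `[0, T] -> torus_fun L (u t)) ->
  (forall t i, t \in `]0, T[ -> dirC1 L i (J t i)) ->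
  (forall t x, t \in `]0, T[ -> ptime u t x = - \sum_i partial i (J t i) x) ->
  forall t, t \in `[0, T] -> torus_int L (u t) = torus_int L (u 0).
Proof.
move=> [cu du eu _] uper cJ eq.
have [W' [cW dW _ W'E]] := torus_int_time_derivative cu uper du eu.
have W'0 t : t \in `]0, T[ -> W' t = 0.
  move=> tT; rewrite W'E//.
  have -> : ptime u t = (fun x => - (\sum_i partial i (J t i) x)) by apply/funext => x; exact: eq.
  have cS : torus_cont L (fun x => \sum_i partial i (J t i) x).
    by apply: torus_cont_sum => i; apply: dirC1_partial; exact: cJ.
  have -> : torus_int L (fun x => - (\sum_i partial i (J t i) x)) = -1 * torus_int L (fun x => \sum_i partial i (J t i) x).
    rewrite -(torus_intZ _ (torus_cont_integrable L0 cS)); congr torus_int.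
    by apply/funext => x; rewrite mulN1r.
  rewrite (torus_int_divergence L0) ?mulr0// => i; by have [] := cJ t i tT.
move=> t; rewrite in_itv/= => /andP[t0 tT].
have [<-//|t0'] := eqVneq 0 t.
have {t0 t0'}t0 : 0 < t by rewrite lt_neqAle t0'.
have dW' s : s \in `]0, t[ -> is_derive s 1 (fun t => torus_int L (u t)) (W' s).
  by move=> st; apply: dW; move: st; rewrite !in_itv/=; lra.
have cW' : {within `[0, t], continuous (fun t => torus_int L (u t))}.
  by apply: continuous_subspaceW cW => s /=; rewrite !in_itv/=; lra.
have [c ct] := MVT t0 dW' cW'.
rewrite W'0 ?mul0r; last by move: ct; rewrite !in_itv/=; lra.
by move/eqP; rewrite subr_eq0 => /eqP.
Qed.

End transport.

(** * Passing to the limit in the regularized entropy *)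
Section vanishing_regularization.
Context {R : realType}.

(** The term b - a integrates to 0 for densities of equal mass and makes the
    limit nonnegative, as Fatou's lemma requires.  For a = 0 the value is
    squeezed between the Hellinger bound and b; for a > 0 = b the logarithm
    of e n sends it to infinity. *)
Lemma rel_ent_cvg (a b : R) (e : R^nat) : 0 <= a -> 0 <= b ->
  (forall n, 0 < e n) -> e @ \oo --> (0 : R) ->
  (rel_ent (a + e n) (b + e n))%:E @[n --> \oo] --> (kl_integrand a b + (b - a)%:E)%E.
Proof.
move=> a0 b0 e0 ce.
have cD (c : R) : (c + e n) @[n --> \oo] --> c.
  by rewrite -[X in _ --> X]addr0; apply: cvgD => //; exact: cvg_cst.
have D0 (c : R) n : 0 <= c -> 0 < c + e n by move=> c0; rewrite ltr_wpDl.
rewrite /kl_integrand; have [az|az] := eqVneq a 0.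
  rewrite az subr0 add0e; apply: cvg_EFin; first exact: nearW.
  apply: (@squeeze_cvgr _ _ _ _ (fun n => (Num.sqrt (0 + e n) - Num.sqrt (b + e n)) ^+ 2) (cst b)).
  - apply: nearW => n; rewrite rel_ent_hellinger ?D0//= /rel_ent add0r.
    have : e n * ln (e n) <= e n * ln (b + e n).
      by rewrite ler_pM2l// ler_ln ?posrE ?D0// lerDr.
    lra.
  - have sc (c : R) : Num.sqrt (c + e n) @[n --> \oo] --> Num.sqrt c.
      by apply: (cvg_comp _ _ (cD c)); exact: sqrt_continuous.
    rewrite (_ : nbhs b = nbhs ((Num.sqrt 0 - Num.sqrt b) ^+ 2)); last first.
      by rewrite sqrtr0 sub0r sqrrN sqr_sqrtr.
    by under eq_fun do rewrite expr2; rewrite expr2; apply: cvgM; apply: cvgB.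
  - exact: cvg_cst.
have {az}a1 : 0 < a by rewrite lt_neqAle eq_sym az.
have [bz|bz] := eqVneq b 0.
  rewrite addye//; apply/cvgeyPger => A _.
  have /cvgr_lt/(_ (expR (ln a - (A + a) / a))) H := ce.
  have {}H := H (expR_gt0 _).
  near=> n; rewrite lee_fin /rel_ent bz add0r.
  have en : e n < expR (ln a - (A + a) / a) by near: n.
  have l1 : ln (e n) < ln a - (A + a) / a by rewrite -[ltRHS]expRK ltr_ln ?posrE ?expR_gt0.
  have l2 : ln a <= ln (a + e n) by rewrite ler_ln ?posrE ?D0// lerDl ltW.
  have l3 : (A + a) / a <= ln (a + e n) - ln (e n) by lra.
  have l4 : a * ((A + a) / a) <= a * (ln (a + e n) - ln (e n)) by rewrite ler_pM2l.
  have l5 : a * (ln (a + e n) - ln (e n)) <= (a + e n) * (ln (a + e n) - ln (e n)).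
    apply: ler_wpM2r; last by rewrite lerDl ltW.
    by rewrite subr_ge0 ler_ln ?posrE ?D0// lerDr.
  have l6 : a * ((A + a) / a) = A + a by field; rewrite gt_eqF.
  lra.
have {bz}b1 : 0 < b by rewrite lt_neqAle eq_sym bz.
rewrite -EFinD; apply: cvg_EFin; first exact: nearW.
have -> : a * ln (a / b) + (b - a) = a * (ln a - ln b) - a + b.
  by rewrite ln_div ?posrE//; ring.
have lc (c : R) : 0 < c -> ln (c + e n) @[n --> \oo] --> ln c.
  by move=> c0; apply: (cvg_comp _ _ (cD c)); exact: continuous_ln.
apply: cvgD => //; apply: cvgB => //; apply: cvgM => //.
by apply: cvgB; exact: lc.
Unshelve. all: by end_near. Qed.

Lemma fatou_cvg_le d (S : measurableType d) (m : {measure set S -> \bar R})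
    (h : (S -> R)^nat) (g : S -> \bar R) (c : R^nat) (l : R) :
  (forall n, measurable_fun setT (EFin \o h n)) -> (forall n x, 0 <= h n x) ->
  (forall x, (h n x)%:E @[n --> \oo] --> g x) ->
  (forall n, (\int[m]_x (h n x)%:E <= (c n)%:E)%E) -> c @ \oo --> l ->
  (\int[m]_x g x <= l%:E)%E.
Proof.
move=> mh h0 hg hc cl.
have -> : (\int[m]_x g x = \int[m]_x limn_einf (fun n => (h n x)%:E))%E.
  apply: eq_integral => x _; rewrite is_cvg_limn_einfE; last by apply/cvg_ex; exists (g x).
  by apply/esym/cvg_lim.
apply: (le_trans (fatou m measurableT mh _)) => [n x _|]; first by rewrite lee_fin.
have cl' : (c n)%:E @[n --> \oo] --> l%:E by apply: cvg_EFin => //; exact: nearW.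
rewrite -(cvg_lim _ cl')// limn_einf_lim; apply: lee_lim.
- exact: is_cvg_einfs.
- by apply/cvg_ex; exists l%:E.
- apply: nearW => n; apply: le_trans (hc n).
  by apply: ereal_inf_lbound; exists n => /=.
Qed.

End vanishing_regularization.

(** * Regularity of functions on the time slab *)
Section regularity.
Context {R : realType} {d : nat}.
Variable L : R.
Hypothesis L0 : 0 < L.
Variable T : R.
Hypothesis T0 : 0 < T.
Implicit Types (u w : R -> 'rV[R]_d -> R).

Lemma slab_continuous_clamp u u' : jointly_continuous u' ->
  (forall t, t \in `[0, T] -> u' t = u t) -> slab_continuous T u.
Proof.
move=> cu' E.
have : {within `[0, T]%classic `*` setT, continuous (fun p : R * 'rV[R]_d => u' p.1 p.2)}.
  exact: continuous_subspaceT.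
by apply: subspace_eq_continuous => p; rewrite inE => -[/= pT _]; rewrite /from_subspace/= E.
Qed.

Lemma slab_extends_clamp w : slab_extends T w ->
  exists2 G, jointly_continuous G & forall t, t \in `]0, T[ -> G t = w t.
Proof.
move=> [G cG GE]; exists (fun t x => G (clamp T t) x).
  exact: jointly_continuous_clamp (ltW T0) cG.
move=> t tT; apply/funext => x; rewrite clamp_id ?GE//.
exact: subset_itv_oo_cc.
Qed.

Lemma slab_extends_continuous w t : slab_extends T w -> t \in `]0, T[ -> continuous (w t).
Proof.
by move=> /slab_extends_clamp[G cG GE] tT; rewrite -GE//; exact: jointly_continuousW.
Qed.

Lemma slab_extends_bounded w : slab_extends T w ->
  (forall t, t \in `]0, T[ -> torus_fun L (w t)) ->
  exists2 M : R, 0 <= M & forall t x, t \in `]0, T[ -> `|w t x| <= M.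
Proof.
move=> /slab_extends_clamp[G cG GE] wper.
have [|M M0 GM] := jointly_continuous_bounded L0 (a := 0) (b := T) cG.
  by move=> t tT; rewrite GE//; exact: wper.
by exists M => // t x tT; rewrite -GE//; exact: GM.
Qed.

Lemma slab_continuous_bounded u : slab_continuous T u ->
  (forall t, t \in `[0, T] -> torus_fun L (u t)) ->
  exists2 M : R, 0 <= M & forall t x, t \in `]0, T[ -> `|u t x| <= M.
Proof.
move=> cu uper; apply: slab_extends_bounded; first by exists u.
by move=> t tT; apply: uper; exact: subset_itv_oo_cc.
Qed.

Lemma slab_continuous_torus_cont u t : slab_continuous T u ->
  (forall t, t \in `[0, T] -> torus_fun L (u t)) -> t \in `[0, T] -> torus_cont L (u t).
Proof.
move=> cu uper tT; split; last exact: uper.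
by have := jointly_continuousW (t := t) (jointly_continuous_clamp (ltW T0) cu); rewrite clamp_id.
Qed.

Lemma slab_C1_dirC1 u t i : slab_C1 T u ->
  (forall t, t \in `[0, T] -> torus_fun L (u t)) -> t \in `]0, T[ -> dirC1 L i (u t).
Proof.
move=> [cu _ _ ux] uper tT; have [dux eux] := ux i; split.
- by apply: slab_continuous_torus_cont => //; exact: subset_itv_oo_cc.
- by move=> x; exact: dux.
- exact: (slab_extends_continuous eux).
Qed.

Lemma slab_C12_dirC1 u t i j : slab_C12 T u ->
  (forall t, t \in `[0, T] -> torus_fun L (u t)) -> t \in `]0, T[ ->
  dirC1 L j (partial i (u t)).
Proof.
move=> [u1 u2] uper tT; have [duij euij] := u2 i j; split.
- exact: dirC1_partial (slab_C1_dirC1 i u1 uper tT).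
- by move=> x; exact: duij.
- exact: (slab_extends_continuous euij).
Qed.

Lemma dirC1_kconv i (k phi : 'rV[R]_d -> R) : torus_integrable L k -> torus_fun L k -> dirC1 L i phi ->
  dirC1 L i (kconv L k phi) /\ partial i (kconv L k phi) = kconv L k (partial i phi).
Proof.
move=> ik kper Hphi; have [cphi dphi cdphi] := Hphi.
apply: dirC1_intro.
- by split; [exact: kconv_continuous|exact: kconv_torus_fun].
- by move=> x; apply: kconv_is_derive.
- by apply: kconv_continuous => //; exact: dirC1_partial Hphi.
Qed.

Lemma bounded_family (I : finType) (w : I -> R -> 'rV[R]_d -> R) :
  (forall i, exists2 M : R, 0 <= M & forall t x, t \in `]0, T[ -> `|w i t x| <= M) ->
  exists2 M : R, 0 <= M & forall i t x, t \in `]0, T[ -> `|w i t x| <= M.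
Proof.
move=> H; have /choice[M MP] : forall i, exists M : R, 0 <= M /\ forall t x, t \in `]0, T[ -> `|w i t x| <= M.
  by move=> i; have [M ? ?] := H i; exists M.
exists (\sum_i M i); first by apply: sumr_ge0 => i _; have [] := MP i.
move=> i t x tT; have [_ wM] := MP i; apply: le_trans (wM t x tT) _.
by rewrite (bigD1 i)//= lerDl sumr_ge0// => j _; have [] := MP j.
Qed.

End regularity.

(** * The two evolutions *)

(** Throughout, q is the McKean-Vlasov density and p the density transported
    by f. *)
Section system.
Variables (R : realType) (d : nat) (L nu T : R)
  (V : 'rV[R]_d -> R) (K : 'rV[R]_d -> 'rV[R]_d)
  (f : R -> 'rV[R]_d -> 'rV[R]_d) (q p : R -> 'rV[R]_d -> R).
Hypotheses (L0 : 0 < L) (nu0 : 0 < nu) (T0 : 0 < T)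
  (V_per : torus_fun L V) (V_C2 : class_C2 V)
  (K_per : torus_fun L K) (K_Linfty : is_Linfty L K)
  (q0_density : is_prob_density L (q 0))
  (q_sol : mckean_vlasov_solution nu L T V K q)
  (f_C1 : class_C1_velocity L T f)
  (p_sol : continuity_solution L T f p)
  (p0 : p 0 = q 0).
Local Notation mu := (torus_measure L d).
Local Notation Kc i := (fun z => K z ord0 i).

Let oo_cc t : t \in `]0, T[ -> t \in `[0, T].
Proof. exact: subset_itv_oo_cc. Qed.

Let zT : 0 \in `[0, T].
Proof. by rewrite in_itv/= lexx ltW. Qed.

Let q_per t : t \in `[0, T] -> torus_fun L (q t).
Proof. by case: q_sol => H _ _; exact: H. Qed.
Let q_C12 : slab_C12 T q.
Proof. by case: q_sol. Qed.
Let q_C1 : slab_C1 T q.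
Proof. by case: q_C12. Qed.
Let p_per t : t \in `[0, T] -> torus_fun L (p t).
Proof. by case: p_sol => H _ _; exact: H. Qed.
Let p_C1 : slab_C1 T p.
Proof. by case: p_sol. Qed.
Let q_cont t : t \in `[0, T] -> torus_cont L (q t).
Proof. by move=> tT; apply: (slab_continuous_torus_cont T0) => //; case: q_C1. Qed.
Let p_cont t : t \in `[0, T] -> torus_cont L (p t).
Proof. by move=> tT; apply: (slab_continuous_torus_cont T0) => //; case: p_C1. Qed.

(** The density q 0 has integral 1. *)
Lemma torus_measure_gt0 : (0 < mu setT)%E.
Proof.
rewrite lt0e measure_ge0 andbT; apply/eqP => mu0.
have [_ H] := q0_density.
have mq := torus_cont_measurable (q_cont zT).
have := @null_set_integral _ _ _ mu setT _ measurableT ((measurable_EFinP _ _).2 mq) mu0.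
move=> E; have : (1 = 0 :> \bar R)%E by rewrite -E; exact/esym/H.
by move/eqP; rewrite onee_eq0.
Qed.

Lemma mass_q0 : torus_int L (q 0) = 1.
Proof. by have [_ H] := q0_density; rewrite /torus_int /Rintegral H. Qed.

Let kint i := kernel_coord_integrable L0 K_Linfty torus_measure_gt0 i.
Let kper i := kernel_coord_per K_per i.

Definition drift t y := - grad V y + convolution L K (q t) y.

Lemma driftE t i : (fun y => drift t y ord0 i) =
  (fun y => - partial i V y + kconv L (Kc i) (q t) y).
Proof. by apply/funext => y; rewrite !mxE. Qed.

Let dirC1_V i j : dirC1 L j (partial i V).
Proof.
have [V1 V2] := V_C2; split.
- by split; [case: (V1 i)|exact: torus_fun_partial].
- by case: (V2 i j).
- by case: (V2 i j).
Qed.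

Let dirC1_q t i : t \in `]0, T[ -> dirC1 L i (q t).
Proof. by move=> tT; exact: (slab_C1_dirC1 T0). Qed.
Let dirC1_p t i : t \in `]0, T[ -> dirC1 L i (p t).
Proof. by move=> tT; exact: (slab_C1_dirC1 T0). Qed.
Let dirC1_f t i j : t \in `]0, T[ -> dirC1 L j (fun y => f t y ord0 i).
Proof.
have [fper f1] := f_C1; move=> tT.
apply: (@slab_C1_dirC1 _ _ _ _ T0 (fun t y => f t y ord0 i)) => // s sT j' x.
by rewrite fper.
Qed.

Lemma drift_dirC1 t i : t \in `]0, T[ -> dirC1 L i (fun y => drift t y ord0 i) /\
  partial i (fun y => drift t y ord0 i) =
  (fun y => - partial i (partial i V) y + kconv L (Kc i) (partial i (q t)) y).
Proof.
move=> tT; rewrite driftE.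
have [H1 E1] := dirC1N (dirC1_V i i).
have [H2 E2] := dirC1_kconv L0 (kint i) (kper i) (dirC1_q i tT).
by have [H3 E3] := dirC1D H1 H2; rewrite E3 E1 E2.
Qed.

Lemma drift_bounded : exists2 M : R, 0 <= M &
  forall i t x, t \in `]0, T[ -> `|drift t x ord0 i| <= M.
Proof.
apply: (bounded_family (w := fun i t x => drift t x ord0 i)) => i.
have [[cV perV] _ _] := dirC1_V i i.
have [M1 M10 VM] := torus_fun_bounded L0 cV perV.
have [cq _ _ _] := q_C1; have [M2 M20 qM] := slab_continuous_bounded L0 T0 cq q_per.
set I := torus_int L (fun y => `|K y ord0 i|).
have I0 : 0 <= I by apply: Rintegral_ge0.
exists (M1 + M2 * I); first by rewrite addr_ge0// mulr_ge0.
move=> t x tT; have /(congr1 (@^~ x)) -> := driftE t i.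
rewrite (le_trans (ler_normD _ _))// lerD ?normrN//.
by apply: (kconv_le L0 (kint i) (kper i)); [exact/q_cont/oo_cc|move=> y; exact: qM].
Qed.

Lemma drift_divergence_bounded : exists2 M : R, 0 <= M &
  forall t x, t \in `]0, T[ -> `|divergence (drift t) x| <= M.
Proof.
have [|M M0 HM] := @bounded_family R d T 'I_d (fun i t x => partial i (fun y => drift t y ord0 i) x).
  move=> i.
  have [_ _ cV] := dirC1_V i i; have perV := torus_fun_partial i (torus_fun_partial i V_per).
  have [M1 M10 VM] := torus_fun_bounded L0 cV perV.
  have [_ _ _ qx] := q_C1; have [_ eqx] := qx i.
  have [|M2 M20 qM] := slab_extends_bounded L0 T0 eqx.
    by move=> t tT; apply: torus_fun_partial; exact/q_per/oo_cc.
  set I := torus_int L (fun y => `|K y ord0 i|).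
  have I0 : 0 <= I by apply: Rintegral_ge0.
  exists (M1 + M2 * I); first by rewrite addr_ge0// mulr_ge0.
  move=> t x tT; have [_ ->] := drift_dirC1 i tT.
  rewrite (le_trans (ler_normD _ _))// lerD ?normrN//.
  apply: (kconv_le L0 (kint i) (kper i)); last by move=> y; exact: qM.
  exact: dirC1_partial (dirC1_q i tT).
exists (\sum_(i < d) M); first by apply: sumr_ge0.
move=> t x tT; rewrite (le_trans (ler_norm_sum _ _ _))//.
by apply: ler_sum => i _; exact: HM.
Qed.

Lemma velocity_divergence_bounded : exists2 M : R, 0 <= M &
  forall t x, t \in `]0, T[ -> `|divergence (f t) x| <= M.
Proof.
have [fper f1] := f_C1.
have [|M M0 HM] := @bounded_family R d T 'I_d (fun i t x => partial i (fun y => f t y ord0 i) x).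
  move=> i; have [_ _ _ fx] := f1 i; have [_ efx] := fx i.
  apply: (slab_extends_bounded L0 T0 efx) => t tT.
  by apply: torus_fun_partial => j x; rewrite fper//; exact: oo_cc.
exists (\sum_(i < d) M); first by apply: sumr_ge0.
move=> t x tT; rewrite (le_trans (ler_norm_sum _ _ _))//.
by apply: ler_sum => i _; exact: HM.
Qed.

(** The diffusion term is the source: a Laplacian is nonnegative at a
    minimum. *)
Lemma q_ge0 t x : t \in `[0, T] -> 0 <= q t x.
Proof.
have [M M0 HM] := drift_divergence_bounded.
have [_ _ qeq] := q_sol.
apply: (transport_nonneg L0 T0 (beta := drift) (r := fun t x => nu * laplacian (q t) x) q_C1 q_per _ _ _ _ HM).
- by have [] := q0_density.
- exact: qeq.
- move=> s y sT ymin; apply: mulr_ge0; first exact: ltW.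
  apply: sumr_ge0 => i _.
  have [_ dq _] := dirC1_q i sT; apply: partial2_min => //.
  by have [_ dqq _] := slab_C12_dirC1 T0 i i q_C12 q_per sT.
- by move=> s i y sT; have [[_ H _] _] := drift_dirC1 i sT.
Qed.

Lemma p_ge0 t x : t \in `[0, T] -> 0 <= p t x.
Proof.
have [M M0 HM] := velocity_divergence_bounded.
have [_ _ peq] := p_sol.
apply: (transport_nonneg L0 T0 (beta := f) (r := fun t x => 0) p_C1 p_per _ _ _ _ HM) => //.
- by move=> y; rewrite p0; have [] := q0_density.
- by move=> s i y sT; have [_ H _] := dirC1_f i i sT.
Qed.

Definition flux_p t (i : 'I_d) y := p t y * f t y ord0 i.
Definition flux_q t (i : 'I_d) y := q t y * drift t y ord0 i - nu * partial i (q t) y.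

Lemma flux_p_dirC1 t i : t \in `]0, T[ -> dirC1 L i (flux_p t i).
Proof. by move=> tT; have [] := dirC1M (dirC1_p i tT) (dirC1_f i i tT). Qed.

Lemma flux_q_dirC1 t i : t \in `]0, T[ -> dirC1 L i (flux_q t i).
Proof.
move=> tT; have [H1 _] := dirC1M (dirC1_q i tT) (drift_dirC1 i tT).1.
have [H2 _] := dirC1M (dirC1_cst L i nu).1 (slab_C12_dirC1 T0 i i q_C12 q_per tT).
by have [] := dirC1B H1 H2.
Qed.

Lemma p_balance t x : t \in `]0, T[ -> ptime p t x = - \sum_i partial i (flux_p t i) x.
Proof.
move=> tT; have [_ _ /(_ t x tT) /eqP] := p_sol; rewrite addr_eq0 => /eqP ->.
congr (- _); apply: eq_bigr => i _; congr (partial i _ x).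
by apply/funext => y; rewrite mxE.
Qed.

Lemma q_balance t x : t \in `]0, T[ -> ptime q t x = - \sum_i partial i (flux_q t i) x.
Proof.
move=> tT; have [_ _ /(_ t x tT) /eqP] := q_sol; rewrite -subr_eq0 -addrA addr_eq0 => /eqP ->.
congr (- _); rewrite /divergence /laplacian mulr_sumr -sumrB; apply: eq_bigr => i _.
have [H1 _] := dirC1M (dirC1_q i tT) (drift_dirC1 i tT).1.
have [H2 E2] := dirC1M (dirC1_cst L i nu).1 (slab_C12_dirC1 T0 i i q_C12 q_per tT).
have [H3 E3] := dirC1B H1 H2.
rewrite /flux_q [RHS](congr1 (@^~ x) E3) E2 (dirC1_cst L i nu).2/= mulr0 addr0.
congr (partial i _ x - _).
by apply/funext => y; rewrite mxE.
Qed.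

Lemma p_mass t : t \in `[0, T] -> torus_int L (p t) = 1.
Proof.
move=> tT; rewrite -mass_q0 -p0.
by apply: (mass_conserved L0 T0 (J := flux_p)) => // *; [exact: flux_p_dirC1|exact: p_balance].
Qed.

Lemma q_mass t : t \in `[0, T] -> torus_int L (q t) = 1.
Proof.
move=> tT; rewrite -mass_q0.
by apply: (mass_conserved L0 T0 (J := flux_q)) => // *; [exact: flux_q_dirC1|exact: q_balance].
Qed.

(** * Entropy production of the regularized densities *)
Section regularized.
Variable eps : R.
Hypothesis eps0 : 0 < eps.

Definition regp t x := p t x + eps.
Definition regq t x := q t x + eps.
Definition logratio t x := ln (regp t x) - ln (regq t x).
Definition ent_density t x := rel_ent (regp t x) (regq t x).
Definition grad_logratio t (i : 'I_d) x :=
  (regp t x)^-1 * partial i (p t) x - (regq t x)^-1 * partial i (q t) x.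
(** What remains of the time derivative of the entropy density after removing
    a divergence; expR (logratio t x) is the quotient regp t x / regq t x. *)
Definition ent_production t x :=
  \sum_i grad_logratio t i x * (flux_p t i x - expR (logratio t x) * flux_q t i x).

Let P_ge t x : t \in `[0, T] -> eps <= regp t x.
Proof. by move=> tT; rewrite lerDr; exact: p_ge0. Qed.
Let Q_ge t x : t \in `[0, T] -> eps <= regq t x.
Proof. by move=> tT; rewrite lerDr; exact: q_ge0. Qed.
Let P_gt0 t x : t \in `[0, T] -> 0 < regp t x.
Proof. by move=> tT; apply: lt_le_trans (P_ge x tT). Qed.
Let Q_gt0 t x : t \in `[0, T] -> 0 < regq t x.
Proof. by move=> tT; apply: lt_le_trans (Q_ge x tT). Qed.

Lemma exp_logratio t x : t \in `[0, T] -> expR (logratio t x) = regp t x / regq t x.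
Proof.
by move=> tT; rewrite expRB !lnK// posrE; [exact: Q_gt0|exact: P_gt0].
Qed.

Let dirC1_lnD (u : R -> 'rV[R]_d -> R) t i : (forall x, 0 < u t x + eps) -> dirC1 L i (u t) ->
  dirC1 L i (fun x => ln (u t x + eps)) /\
  partial i (fun x => ln (u t x + eps)) = (fun x => (u t x + eps)^-1 * partial i (u t) x).
Proof.
move=> u0 Hu; have [H1 E1] := dirC1D Hu (dirC1_cst L i eps).1.
have [|x|H2 E2] := dirC1_comp (f := @ln R) (f' := GRing.inv) H1.
- by move=> x; apply: is_derive1_ln; exact: u0.
- by apply: inv_continuous; rewrite gt_eqF//; exact: u0.
split => //; apply: etrans E2 _; apply/funext => x; congr (_ * _).
by rewrite E1 (dirC1_cst L i eps).2/= addr0.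
Qed.

Lemma logratio_dirC1 t i : t \in `]0, T[ ->
  dirC1 L i (logratio t) /\ partial i (logratio t) = grad_logratio t i.
Proof.
move=> tT; have tT' := oo_cc tT.
have [H1 E1] := dirC1_lnD (fun x => P_gt0 x tT') (dirC1_p i tT).
have [H2 E2] := dirC1_lnD (fun x => Q_gt0 x tT') (dirC1_q i tT).
by have [H3 E3] := dirC1B H1 H2; split => //; rewrite [LHS]E3 E1 E2.
Qed.

Lemma exp_logratio_dirC1 t i : t \in `]0, T[ ->
  dirC1 L i (fun x => 1 - expR (logratio t x)) /\
  partial i (fun x => 1 - expR (logratio t x)) =
  (fun x => - (expR (logratio t x) * grad_logratio t i x)).
Proof.
move=> tT; have [H1 E1] := logratio_dirC1 i tT.
have [x|H2 E2] := dirC1_comp (f := @expR R) (f' := @expR R) H1.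
  exact: continuous_expR.
have [H3 E3] := dirC1B (dirC1_cst L i 1).1 H2; split => //.
rewrite [LHS]E3 E2 E1; apply/funext => x.
by rewrite (dirC1_cst L i 1).2/= sub0r.
Qed.

Lemma grad_logratio_cont t i : t \in `]0, T[ -> torus_cont L (grad_logratio t i).
Proof.
by move=> tT; have [H <-] := logratio_dirC1 i tT; exact: dirC1_partial.
Qed.

Lemma ent_production_cont t : t \in `]0, T[ -> torus_cont L (ent_production t).
Proof.
move=> tT; apply: torus_cont_sum => i; apply: torus_contM; first exact: grad_logratio_cont.
apply: torus_contB; first by case: (flux_p_dirC1 i tT).
apply: torus_contM; last by case: (flux_q_dirC1 i tT).
apply: (torus_cont_comp (f := @expR R)); first by move=> x; exact: continuous_expR.
by case: (logratio_dirC1 i tT) => -[].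
Qed.

Lemma ent_density_derive t x : t \in `]0, T[ ->
  is_derive t 1 (ent_density ^~ x)
    (logratio t x * ptime p t x + (1 - expR (logratio t x)) * ptime q t x).
Proof.
move=> tT; have tT' := oo_cc tT.
have [_ /(_ t x tT) dp _ _] := p_C1; have [_ /(_ t x tT) dq _ _] := q_C1.
have dP : is_derive t 1 (regp ^~ x) (ptime p t x).
  have : is_derive t 1 (p ^~ x) (ptime p t x) by apply: DeriveDef => //; rewrite /ptime derive1E.
  by move=> ?; rewrite /regp; apply: is_derive_eq; rewrite addr0.
have dQ : is_derive t 1 (regq ^~ x) (ptime q t x).
  have : is_derive t 1 (q ^~ x) (ptime q t x) by apply: DeriveDef => //; rewrite /ptime derive1E.
  by move=> ?; rewrite /regq; apply: is_derive_eq; rewrite addr0.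
have dlP : is_derive t 1 (fun s => ln (regp s x)) ((regp t x)^-1 * ptime p t x).
  by apply: (@is_derive1_comp _ (@ln R) (regp ^~ x)) => //; apply: is_derive1_ln; exact: P_gt0.
have dlQ : is_derive t 1 (fun s => ln (regq s x)) ((regq t x)^-1 * ptime q t x).
  by apply: (@is_derive1_comp _ (@ln R) (regq ^~ x)) => //; apply: is_derive1_ln; exact: Q_gt0.
have -> : ent_density ^~ x = (fun s => regp s x * (ln (regp s x) - ln (regq s x)) - regp s x + regq s x) by [].
apply: is_derive_eq; rewrite exp_logratio// /logratio /GRing.scale/=.
have P0 := P_gt0 x tT'; have Q0 := Q_gt0 x tT'.
by field; rewrite !gt_eqF.
Qed.

Let clamp_in t : clamp T t \in `[0, T].
Proof. by apply: clamp_itv; exact: ltW. Qed.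

Let cP : jointly_continuous (fun t => regp (clamp T t)).
Proof.
move=> z; apply: cvgD; last exact: cvg_cst.
by case: p_C1 => cp _ _ _; exact: (jointly_continuous_clamp (ltW T0) cp).
Qed.

Let cQ : jointly_continuous (fun t => regq (clamp T t)).
Proof.
move=> z; apply: cvgD; last exact: cvg_cst.
by case: q_C1 => cq _ _ _; exact: (jointly_continuous_clamp (ltW T0) cq).
Qed.

Let cg : jointly_continuous (fun t => logratio (clamp T t)).
Proof.
move=> z; apply: cvgB.
- apply: (@continuous_comp _ _ _ (fun z : R * 'rV[R]_d => regp (clamp T z.1) z.2) (@ln R)).
    exact: cP.
  by apply: continuous_ln; exact: P_gt0.
- apply: (@continuous_comp _ _ _ (fun z : R * 'rV[R]_d => regq (clamp T z.1) z.2) (@ln R)).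
    exact: cQ.
  by apply: continuous_ln; exact: Q_gt0.
Qed.

Lemma ent_density_slab_continuous : slab_continuous T ent_density.
Proof.
apply: (@slab_continuous_clamp _ _ _ _ (fun t => ent_density (clamp T t))).
  move=> z; apply: cvgD; last exact: cQ.
  by apply: cvgB; [apply: cvgM; [exact: cP|exact: cg]|exact: cP].
by move=> t tT; rewrite clamp_id.
Qed.

Lemma ent_density_per t : t \in `[0, T] -> torus_fun L (ent_density t).
Proof. by move=> tT i x; rewrite /ent_density /regp /regq p_per// q_per. Qed.

Lemma ent_density_ptime t x : t \in `]0, T[ -> ptime ent_density t x =
  logratio t x * ptime p t x + (1 - expR (logratio t x)) * ptime q t x.
Proof. by move=> tT; rewrite /ptime derive1E; have [_ ->] := ent_density_derive x tT. Qed.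

Lemma ent_density_ptime_extends : slab_extends T (ptime ent_density).
Proof.
have [_ _ /(slab_extends_clamp T0)[Gp cGp GpE] _] := p_C1.
have [_ _ /(slab_extends_clamp T0)[Gq cGq GqE] _] := q_C1.
exists (fun t x => logratio (clamp T t) x * Gp t x + (1 - expR (logratio (clamp T t) x)) * Gq t x).
  apply: continuous_subspaceT => z; apply: cvgD; apply: cvgM; [exact: cg|exact: cGp| |exact: cGq].
  apply: cvgB; first exact: cvg_cst.
  apply: (@continuous_comp _ _ _ (fun z : R * 'rV[R]_d => logratio (clamp T z.1) z.2) (@expR R)).
    exact: cg.
  exact: continuous_expR.
by move=> t x tT; rewrite ent_density_ptime// GpE// GqE// clamp_id// oo_cc.
Qed.

(** With g = log (P / Q), the time derivative of the density of the entropy is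
    g d/dt p + (1 - exp g) d/dt q.  Insert the two balance laws and integrate
    by parts: F is the total flux whose divergence integrates to 0. *)
Lemma torus_int_ent_rate t : t \in `]0, T[ ->
  torus_int L (ptime ent_density t) = torus_int L (ent_production t).
Proof.
move=> tT.
pose F i x := logratio t x * flux_p t i x + (1 - expR (logratio t x)) * flux_q t i x.
have HF i : dirC1 L i (F i) /\ partial i (F i) =
    (fun x => logratio t x * partial i (flux_p t i) x + (1 - expR (logratio t x)) * partial i (flux_q t i) x
     + grad_logratio t i x * (flux_p t i x - expR (logratio t x) * flux_q t i x)).
  have [Hg Eg] := logratio_dirC1 i tT; have [Hk Ek] := exp_logratio_dirC1 i tT.
  have [H1 E1] := dirC1M Hg (flux_p_dirC1 i tT).
  have [H2 E2] := dirC1M Hk (flux_q_dirC1 i tT).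
  have [H3 E3] := dirC1D H1 H2; split => //.
  by rewrite [LHS]E3 E1 E2 Eg Ek; apply/funext => x; ring.
have E : ptime ent_density t = (fun x => ent_production t x - \sum_i partial i (F i) x).
  apply/funext => x; rewrite ent_density_ptime// p_balance// q_balance// /ent_production.
  rewrite !mulrN !mulr_sumr -opprD -sumrB -big_split/= -sumrN; apply: eq_bigr => i _.
  by have [_ ->] := HF i; ring.
have cS : torus_cont L (fun x => \sum_i partial i (F i) x).
  by apply: torus_cont_sum => i; apply: dirC1_partial; have [] := HF i.
rewrite E (torus_intB (torus_cont_integrable L0 (ent_production_cont tT)) (torus_cont_integrable L0 cS)).
by rewrite (torus_int_divergence L0) ?subr0// => i; have [[]] := HF i.
Qed.

Definition residual_density t x : R :=
  enorm (f t x + grad V x - convolution L K (p t) x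
         + nu *: grad (fun y => ln (p t y)) x) ^+ 2 * p t x.

Definition l1_dist t := torus_int L (fun y => `|p t y - q t y|).

Let normK := Linfty_norm L K.

Lemma residual_density_ge0 t x : t \in `[0, T] -> 0 <= residual_density t x.
Proof. by move=> tT; rewrite mulr_ge0 ?sqr_ge0//; exact: p_ge0. Qed.

Lemma diff_cont t : t \in `[0, T] -> torus_cont L (fun y => p t y - q t y).
Proof. by move=> tT; apply: torus_contB; [exact: p_cont|exact: q_cont]. Qed.

(** The pointwise form of the main computation.  In each coordinate the flux
    bracket of [ent_production] equals p delta + p c + E b - nu P g, where
    E b = eps (P - Q) / Q b is the price of the regularization; then
    [young3] applies, and the three terms are summed over the coordinates. *)
Lemma ent_production_le (Cb eta t : R) x : 0 < eta -> t \in `]0, T[ ->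
  \sum_i drift t x ord0 i ^+ 2 <= Cb ->
  nu * ent_production t x <=
  residual_density t x + 2^-1 * ((normK * l1_dist t) ^+ 2 * p t x)
  + Cb * (eta * ent_density t x + eps * expR (1 + eta^-1)).
Proof.
move=> eta0 tT bC; have tT' := oo_cc tT.
have P0 := P_gt0 x tT'; have Q0 := Q_gt0 x tT'; have px0 := p_ge0 x tT'.
have pP : p t x <= regp t x by rewrite lerDl ltW.
set g := grad_logratio t.
(* The coordinates of the residual field, switched off where p vanishes. *)
pose delta i := if p t x == 0 then 0 else
  f t x ord0 i + partial i V x - kconv L (Kc i) (p t) x + nu * ((p t x)^-1 * partial i (p t) x).
pose c i := kconv L (Kc i) (p t) x - kconv L (Kc i) (q t) x.
pose E := eps * (regp t x - regq t x) / regq t x.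
have term i : g i x * (flux_p t i x - expR (logratio t x) * flux_q t i x) =
    g i x * (p t x * delta i + p t x * c i + E * drift t x ord0 i) - nu * regp t x * g i x ^+ 2.
  have pd : p t x * delta i = p t x * (f t x ord0 i + partial i V x - kconv L (Kc i) (p t) x) + nu * partial i (p t) x.
    rewrite /delta; have [pz|pz] := eqVneq (p t x) 0; last by field.
    (* A zero of the nonnegative density p t is a minimum. *)
    rewrite pz !mul0r add0r (partial_min _ _) ?mulr0//.
      by have [_ H _] := dirC1_p i tT; exact: H.
    by move=> y; rewrite pz; exact: p_ge0.
  have bE : drift t x ord0 i = - partial i V x + kconv L (Kc i) (q t) x.
    exact: (congr1 (@^~ x) (driftE t i)).
  rewrite pd exp_logratio// /flux_p /flux_q bE /E /c /g /grad_logratio /regp /regq.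
  by field; rewrite !gt_eqF.
have res : residual_density t x = \sum_i p t x * delta i ^+ 2.
  rewrite /residual_density /delta; have [pz|pz] := eqVneq (p t x) 0.
    by rewrite pz mulr0 big1// => i _; rewrite mul0r.
  rewrite sqr_enorm mulr_suml; apply: eq_bigr => i _; rewrite mulrC; congr (_ * _ ^+ 2).
  have px : 0 < p t x by rewrite lt_neqAle eq_sym pz.
  rewrite !mxE; congr (_ + nu * _).
  have dp := dirC1_is_derive x (dirC1_p i tT).
  by have [_ E1] := is_derive_compR (is_derive1_ln px) dp; rewrite /partial E1.
have cE : \sum_i p t x * c i ^+ 2 <= (normK * l1_dist t) ^+ 2 * p t x.
  rewrite -mulr_sumr mulrC ler_wpM2r//.
  have -> : \sum_i c i ^+ 2 = enorm (convolution L K (fun y => p t y - q t y) x) ^+ 2.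
    rewrite sqr_enorm; apply: eq_bigr => i _; congr (_ ^+ 2).
    by rewrite convolutionE /c (kconvB L0 (kint i) (kper i) x (p_cont tT') (q_cont tT')).
  have dist0 : 0 <= l1_dist t by apply: Rintegral_ge0.
  rewrite ler_sqr ?nnegrE ?enorm_ge0//; last by rewrite mulr_ge0// Linfty_norm_ge0.
  exact: (enorm_convolution_le L0 K_per K_Linfty torus_measure_gt0 _ (diff_cont tT')).
have EP : E ^+ 2 / regp t x <= eta * ent_density t x + eps * expR (1 + eta^-1).
  by apply: rel_ent_error => //; [exact: P_ge|exact: Q_ge].
have y0 : 0 <= E ^+ 2 / regp t x by rewrite divr_ge0 ?sqr_ge0// ltW.
have eb : \sum_i E ^+ 2 / regp t x * drift t x ord0 i ^+ 2 <=
    Cb * (eta * ent_density t x + eps * expR (1 + eta^-1)).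
  rewrite -mulr_sumr mulrC; apply: ler_pM => //.
  by apply: sumr_ge0 => i _; exact: sqr_ge0.
rewrite /ent_production (eq_bigr _ (fun i _ => term i)).
have H : \sum_i (g i x * (p t x * delta i + p t x * c i + E * drift t x ord0 i) - nu * regp t x * g i x ^+ 2) <=
  \sum_i (nu^-1 * (p t x * delta i ^+ 2) + (2 * nu)^-1 * (p t x * c i ^+ 2) + nu^-1 * (E ^+ 2 / regp t x * drift t x ord0 i ^+ 2)).
  by apply: ler_sum => i _; exact: young3.
rewrite -(ler_pM2l nu0) in H; apply: (le_trans H).
rewrite (_ : \sum_i _ = nu^-1 * residual_density t x + (2 * nu)^-1 * (\sum_i p t x * c i ^+ 2)
   + nu^-1 * (\sum_i E ^+ 2 / regp t x * drift t x ord0 i ^+ 2)); last first.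
  rewrite res.
  rewrite [in RHS](mulr_sumr _ _ _ nu^-1) [in RHS](mulr_sumr _ _ _ (2 * nu)^-1).
  by rewrite [in RHS](mulr_sumr _ _ _ nu^-1) -!big_split.
have -> : nu * (nu^-1 * residual_density t x + (2 * nu)^-1 * (\sum_i p t x * c i ^+ 2)
   + nu^-1 * (\sum_i E ^+ 2 / regp t x * drift t x ord0 i ^+ 2)) =
  residual_density t x + 2^-1 * (\sum_i p t x * c i ^+ 2) + \sum_i E ^+ 2 / regp t x * drift t x ord0 i ^+ 2.
  by field; rewrite gt_eqF.
by rewrite !lerD// ler_wpM2l// invr_ge0.
Qed.

Definition ent t := torus_int L (ent_density t).
Let X := torus_int L (cst 1 : 'rV[R]_d -> R).

Lemma ent_density_cont t : t \in `[0, T] -> torus_cont L (ent_density t).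
Proof.
move=> tT; apply: (slab_continuous_torus_cont T0 _ _ tT).
  exact: ent_density_slab_continuous.
exact: ent_density_per.
Qed.

Lemma ent_density_ge0 t x : t \in `[0, T] -> 0 <= ent_density t x.
Proof. by move=> tT; apply: rel_ent_ge0; [exact: P_gt0|exact: Q_gt0]. Qed.

Lemma ent_ge0 t : t \in `[0, T] -> 0 <= ent t.
Proof. by move=> tT; apply: Rintegral_ge0 => y _; exact: ent_density_ge0. Qed.

(** Integrate [rel_ent_diff].  The masses of P and Q add up to 2 (1 + eps X),
    and lam is chosen so that this term contributes half of the left side. *)
Lemma l1_dist_sqr_le t : t \in `[0, T] -> l1_dist t ^+ 2 <= 4 * (1 + eps * X) * ent t.
Proof.
move=> tT; have X0 : 0 <= X by apply: Rintegral_ge0.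
have m0 : 0 < 1 + eps * X by rewrite ltr_pwDl// mulr_ge0// ltW.
have e0 := ent_ge0 tT.
have [->|dist0] := eqVneq (l1_dist t) 0.
  by rewrite expr0n/= !mulr_ge0// ltW.
have {}dist0 : 0 < l1_dist t by rewrite lt_neqAle eq_sym dist0/=; apply: Rintegral_ge0.
pose lam := 4 * (1 + eps * X) / l1_dist t.
have lam0 : 0 < lam by rewrite divr_gt0// mulr_gt0.
have ip := torus_cont_integrable L0 (p_cont tT); have iq := torus_cont_integrable L0 (q_cont tT).
have ci : torus_cont L (fun y => lam / 2 * ent_density t y + lam^-1 * (regp t y + regq t y)).
  have cc (c : R) : torus_cont L (cst c : 'rV[R]_d -> R) by exact: torus_cont_cst.
  apply: torus_contD; apply: torus_contM; [exact: cc|exact: ent_density_cont|exact: cc|].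
  by apply: torus_contD; apply: torus_contD; [exact: p_cont|exact: cc|exact: q_cont|exact: cc].
have H : l1_dist t <= lam / 2 * ent t + lam^-1 * (2 * (1 + eps * X)).
  apply: (@le_trans _ _ (torus_int L (fun y => lam / 2 * ent_density t y + lam^-1 * (regp t y + regq t y)))).
    apply: le_torus_int.
    - by have := integrable_norm (torus_cont_integrable L0 (diff_cont tT)).
    - exact: torus_cont_integrable ci.
    - move=> y; have -> : p t y - q t y = regp t y - regq t y by rewrite /regp /regq; ring.
      by apply: rel_ent_diff => //; [exact: P_gt0|exact: Q_gt0].
  have ie := torus_cont_integrable L0 (ent_density_cont tT).
  have cc (c : R) : torus_cont L (cst c : 'rV[R]_d -> R) by exact: torus_cont_cst.
  have cpq : torus_cont L (fun y => p t y + q t y) by apply: torus_contD; [exact: p_cont|exact: q_cont].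
  have cPQ : torus_cont L (fun y => regp t y + regq t y).
    by apply: torus_contD; apply: torus_contD; [exact: p_cont|exact: cc|exact: q_cont|exact: cc].
  rewrite (torus_intD (torus_cont_integrable L0 (torus_contM (cc (lam / 2)) (ent_density_cont tT)))
    (torus_cont_integrable L0 (torus_contM (cc lam^-1) cPQ))).
  rewrite (torus_intZ _ ie) (torus_intZ _ (torus_cont_integrable L0 cPQ)).
  have -> : torus_int L (fun y => regp t y + regq t y) = 2 * (1 + eps * X).
    have -> : (fun y => regp t y + regq t y) = (fun y => (p t y + q t y) + 2 * eps * (cst 1 : 'rV[R]_d -> R) y).
      by apply/funext => y; rewrite /regp /regq /=; ring.
    rewrite torus_intD; last 2 first.
    - exact: torus_cont_integrable cpq.
    - exact: (torus_cont_integrable L0 (torus_contM (cc (2 * eps)) (cc 1))).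
    rewrite torus_intD// p_mass// q_mass// torus_intZ; last exact: torus_cont_integrable (cc 1).
    by rewrite -/X; ring.
  by [].
have E1 : lam / 2 * ent t = 2 * (1 + eps * X) * ent t / l1_dist t by rewrite /lam; field; rewrite gt_eqF.
have E2 : lam^-1 * (2 * (1 + eps * X)) = l1_dist t / 2 by rewrite /lam; field; rewrite !gt_eqF.
rewrite E1 E2 in H.
have : l1_dist t / 2 <= 2 * (1 + eps * X) * ent t / l1_dist t by lra.
rewrite ler_pdivlMr// expr2; lra.
Qed.

(** As eps, eta and eps exp (1 + 1 / eta) tend to 0, the rate tends to
    2 |K|_oo^2 / nu and the source to 0. *)
Definition gronwall_rate (Cb eta : R) := (2 * normK ^+ 2 * (1 + eps * X) + Cb * eta) / nu.
Definition gronwall_source (Cb eta : R) := Cb * (eps * expR (1 + eta^-1)) * X / nu.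

(** Integrate [ent_production_le] over the torus.  The terms whose integrals
    are known are first collected with the entropy production into a
    continuous function Z, so that the residual is compared only once, through
    [ge0_le_lower_integral]. *)
Lemma ent_rate_le (Cb eta t : R) : 0 < eta -> t \in `]0, T[ ->
  (forall x, \sum_i drift t x ord0 i ^+ 2 <= Cb) ->
  ((nu * (torus_int L (ptime ent_density t) - gronwall_rate Cb eta * ent t - gronwall_source Cb eta))%:E <=
   \int[mu]_x (residual_density t (rowt x))%:E)%E.
Proof.
move=> eta0 tT bC; have tT' := oo_cc tT.
pose c1 := 2^-1 * (normK * l1_dist t) ^+ 2; pose c2 := Cb * eta; pose c3 := Cb * (eps * expR (1 + eta^-1)).
pose Z x := nu * ent_production t x - (c1 * p t x + c2 * ent_density t x + c3 * (cst 1 : 'rV[R]_d -> R) x).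
have cc (c : R) : torus_cont L (cst c : 'rV[R]_d -> R) by exact: torus_cont_cst.
have k1 := torus_contM (cc nu) (ent_production_cont tT).
have k2 := torus_contM (cc c1) (p_cont tT').
have k3 := torus_contM (cc c2) (ent_density_cont tT').
have k4 := torus_contM (cc c3) (cc 1).
have k23 := torus_contD k2 k3; have k234 := torus_contD k23 k4.
have cZ : torus_cont L Z := torus_contB k1 k234.
have ZE : torus_int L Z = nu * torus_int L (ent_production t) - (c1 + c2 * ent t + c3 * X).
  rewrite /Z (torus_intB (torus_cont_integrable L0 k1) (torus_cont_integrable L0 k234)).
  rewrite (torus_intD (torus_cont_integrable L0 k23) (torus_cont_integrable L0 k4)).
  rewrite (torus_intD (torus_cont_integrable L0 k2) (torus_cont_integrable L0 k3)).
  rewrite (torus_intZ _ (torus_cont_integrable L0 (ent_production_cont tT))).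
  rewrite (torus_intZ _ (torus_cont_integrable L0 (p_cont tT'))).
  rewrite (torus_intZ _ (torus_cont_integrable L0 (ent_density_cont tT'))).
  by rewrite (torus_intZ _ (torus_cont_integrable L0 (cc 1))) p_mass// mulr1.
apply: (@le_trans _ _ (torus_int L Z)%:E).
  rewrite lee_fin ZE torus_int_ent_rate//.
  have N0 : 0 <= normK ^+ 2 by exact: sqr_ge0.
  have : normK ^+ 2 * l1_dist t ^+ 2 <= normK ^+ 2 * (4 * (1 + eps * X) * ent t).
    by rewrite ler_wpM2l// l1_dist_sqr_le.
  have -> : nu * (torus_int L (ent_production t) - gronwall_rate Cb eta * ent t - gronwall_source Cb eta) =
     nu * torus_int L (ent_production t) - (2 * normK ^+ 2 * (1 + eps * X) * ent t + Cb * eta * ent t + c3 * X).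
    by rewrite /gronwall_rate /gronwall_source /c3; field; rewrite gt_eqF.
  rewrite /c1 /c2 exprMn; lra.
have iZ := torus_cont_integrable L0 cZ.
have -> : (torus_int L Z)%:E = (\int[mu]_x (Z (rowt x))%:E)%E.
  by rewrite /torus_int /Rintegral fineK//; exact: integrable_fin_num iZ.
apply: (@le_trans _ _ (\int[mu]_x (Num.max 0 (Z (rowt x)))%:E)%E).
  apply: le_integral => //.
    have -> : (fun y : d.-tuple (measurableTypeR R) => (Num.max 0 (Z (rowt y)))%:E) =
       (fun y => ((EFin \o (fun y : d.-tuple (measurableTypeR R) => Z (rowt y)))^\+ y)%E).
      by apply/funext => y; rewrite funeposE /= maxC EFin_max.
    exact: integrable_funepos.
  by move=> y _; rewrite lee_fin le_max lexx orbT.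
apply: ge0_le_lower_integral => y _; first by rewrite lee_fin le_max lexx.
rewrite lee_fin ge_max residual_density_ge0//=.
rewrite /Z /c1 /c2 /c3 /=; have := ent_production_le eta0 tT (bC (rowt y)); lra.
Qed.

Lemma ent_bound (Cb eta t : R) : 0 < eta -> 0 <= Cb ->
  (forall t x, t \in `]0, T[ -> \sum_i drift t x ord0 i ^+ 2 <= Cb) ->
  t \in `[0, T] ->
  ((nu * ent t)%:E <= (expR (gronwall_rate Cb eta * T))%:E *
    (residual nu L T V K f p + (nu * gronwall_source Cb eta * T)%:E))%E.
Proof.
move=> eta0 Cb0 bC tT.
have X0 : 0 <= X by apply: Rintegral_ge0.
have [W' [cW dW cW' W'E]] := torus_int_time_derivative L0 T0 ent_density_slab_continuous
  ent_density_per (fun t x tT => @ex_derive _ _ _ _ _ _ _ (ent_density_derive x tT))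
  ent_density_ptime_extends.
pose r s : \bar R := (if s \in `[0%R, T] then \int[mu]_x (residual_density s (rowt x))%:E else 0)%E.
have r0 s : (0 <= r s)%E.
  rewrite /r; case: ifPn => // sT; apply: integral_ge0 => x _.
  by rewrite lee_fin residual_density_ge0.
have -> : residual nu L T V K f p = (\int[@lebesgue_measure R]_(s in `[0%R, T]) r s)%E.
  by apply: eq_integral => s; rewrite inE/= => sT; rewrite /r sT.
apply: (gronwall T0 nu0 _ _ cW dW cW' r0) => //.
- have m0 : 0 <= 1 + eps * X by rewrite addr_ge0// mulr_ge0// ltW.
  have N0 : 0 <= normK ^+ 2 by exact: sqr_ge0.
  apply: divr_ge0; last exact: ltW.
  apply: addr_ge0; last by rewrite mulr_ge0// ltW.
  by apply: mulr_ge0 => //; apply: mulr_ge0.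
- apply: divr_ge0; last exact: ltW.
  by rewrite !mulr_ge0 ?expR_ge0// ltW.
- move=> s sT; rewrite /r (oo_cc sT) W'E//.
  by apply: ent_rate_le => // x; exact: bC.
- rewrite (_ : ent_density 0 = cst 0); first by rewrite /torus_int Rintegral_cst// mul0r.
  by apply/funext => x; rewrite /ent_density /regp /regq p0 /rel_ent subrr mulr0 sub0r addNr.
Qed.

End regularized.

(** * The entropy bound *)

(** The regularized bound with eta = 1 / (n + 1) and
    eps = eta exp (- (1 + 1 / eta)), in the limit. *)
Lemma KL_le_fin t (r : R) : t \in `[0, T] -> residual nu L T V K f p = r%:E ->
  (KL L (p t) (q t) <= (nu^-1 * expR (2 * Linfty_norm L K ^+ 2 / nu * T) * r)%:E)%E.
Proof.
move=> tT resE.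
have [M M0 bM] := drift_bounded.
pose Cb : R := \sum_(i < d) M ^+ 2.
have Cb0 : 0 <= Cb by apply: sumr_ge0 => i _; exact: sqr_ge0.
have bC s x : s \in `]0, T[ -> \sum_i drift s x ord0 i ^+ 2 <= Cb.
  move=> sT; apply: ler_sum => i _; rewrite -[leLHS]real_normK ?num_real//.
  by rewrite ler_sqr ?nnegrE//; exact: bM.
pose eta n : R := n.+1%:R^-1.
pose e n : R := eta n * expR (- (1 + (eta n)^-1)).
have eta0 n : 0 < eta n by rewrite invr_gt0.
have e0 n : 0 < e n by rewrite mulr_gt0// expR_gt0.
have ceta : eta n @[n --> \oo] --> (0 : R) by exact: cvg_harmonic.
have ce : e n @[n --> \oo] --> (0 : R).
  apply: (@squeeze_cvgr _ _ _ _ (cst 0) eta) => //; last exact: cvg_cst.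
  apply: nearW => n; rewrite ltW//= -[leRHS]mulr1 ler_pM2l// -expR0 ler_expR.
  by rewrite oppr_le0 addr_ge0// invr_ge0 ltW.
have eeta n : e n * expR (1 + (eta n)^-1) = eta n.
  by rewrite /e -mulrA -expRD addNr expR0 mulr1.
pose X := torus_int L (cst 1 : 'rV[R]_d -> R).
pose c n := nu^-1 * (expR (gronwall_rate (e n) Cb (eta n) * T) *
   (r + nu * gronwall_source (e n) Cb (eta n) * T)).
have cc : c n @[n --> \oo] --> nu^-1 * expR (2 * Linfty_norm L K ^+ 2 / nu * T) * r.
  have crate : gronwall_rate (e n) Cb (eta n) @[n --> \oo] --> 2 * Linfty_norm L K ^+ 2 / nu.
    rewrite [X in _ --> X](_ : _ = (2 * Linfty_norm L K ^+ 2 * (1 + 0 * X) + Cb * 0) / nu); last first.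
      by rewrite mul0r addr0 mulr1 mulr0 addr0.
    rewrite /gronwall_rate -/X; apply: cvgMr_tmp; apply: cvgD; last by apply: cvgMl_tmp.
    by apply: cvgMl_tmp; apply: cvgD; [exact: cvg_cst|exact: cvgMr_tmp].
  have csource : gronwall_source (e n) Cb (eta n) @[n --> \oo] --> Cb * 0 * X / nu.
    rewrite /gronwall_source; under eq_fun do rewrite eeta -/X.
    by apply: cvgMr_tmp; apply: cvgMr_tmp; exact: cvgMl_tmp.
  rewrite [X in _ --> X](_ : _ = nu^-1 * (expR (2 * Linfty_norm L K ^+ 2 / nu * T) * (r + nu * (Cb * 0 * X / nu) * T))); last first.
    by ring.
  apply: cvgMl_tmp; apply: cvgM.
    have crateT : gronwall_rate (e n) Cb (eta n) * T @[n --> \oo] --> 2 * Linfty_norm L K ^+ 2 / nu * T.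
      exact: cvgMr_tmp.
    by apply: (cvg_comp _ _ crateT); exact: continuous_expR.
  by apply: cvgD; [exact: cvg_cst|apply: cvgMr_tmp; exact: cvgMl_tmp].
(* KL, made nonnegative by a term of zero integral *)
pose g x := (kl_integrand (p t (rowt x)) (q t (rowt x)) + (q t (rowt x) - p t (rowt x))%:E)%E.
pose h n (x : d.-tuple (measurableTypeR R)) := ent_density (e n) t (rowt x).
have ih n : mu.-integrable setT (EFin \o h n).
  exact: (torus_cont_integrable L0 (ent_density_cont (e0 n) tT)).
have mh n : measurable_fun setT (EFin \o h n) by exact: measurable_int (ih n).
have h0 n x : 0 <= h n x by exact: ent_density_ge0.
have hg x : (h n x)%:E @[n --> \oo] --> g x.
  by apply: rel_ent_cvg => //; [exact: p_ge0|exact: q_ge0].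
have g0 x : (0 <= g x)%E.
  rewrite -(cvg_lim _ (hg x))//; apply: lime_ge; first by apply/cvg_ex; exists (g x).
  by apply: nearW => n; rewrite lee_fin.
have mg : measurable_fun setT g by apply: emeasurable_fun_cvg mh _ => x _; exact: hg.
have gle : (\int[mu]_x g x <= (nu^-1 * expR (2 * Linfty_norm L K ^+ 2 / nu * T) * r)%:E)%E.
  apply: (fatou_cvg_le mh h0 hg _ cc) => n.
  have := ent_bound (e0 n) (eta0 n) Cb0 bC tT; rewrite resE -EFinD -EFinM lee_fin.
  have -> : (\int[mu]_x (h n x)%:E)%E = (ent (e n) t)%:E.
    by rewrite /ent /torus_int /Rintegral fineK//; exact: integrable_fin_num (ih n).
  by rewrite lee_fin /c ler_pdivlMl.
have ig : mu.-integrable setT g.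
  apply/integrableP; split => //; under eq_integral do rewrite gee0_abs//.
  exact: le_lt_trans gle (ltry _).
have id : mu.-integrable setT (fun x : d.-tuple (measurableTypeR R) => (p t (rowt x) - q t (rowt x))%:E).
  exact: (torus_cont_integrable L0 (diff_cont tT)).
have -> : KL L (p t) (q t) = (\int[mu]_x (g x + (p t (rowt x) - q t (rowt x))%:E))%E.
  apply: eq_integral => x _; rewrite /g -addeA -EFinD.
  by rewrite addrA subrK subrr adde0.
rewrite integralD//.
have -> : (\int[mu]_x (p t (rowt x) - q t (rowt x))%:E = 0)%E.
  have := torus_intB (torus_cont_integrable L0 (p_cont tT)) (torus_cont_integrable L0 (q_cont tT)).
  rewrite p_mass// q_mass// subrr /torus_int /Rintegral => H.
  by rewrite -[LHS]fineK ?H//; exact: integrable_fin_num id.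
by rewrite adde0.
Qed.

Lemma KL_le t : t \in `[0, T] ->
  (KL L (p t) (q t) <=
   (nu^-1 * expR (2 * Linfty_norm L K ^+ 2 / nu * T))%:E * residual nu L T V K f p)%E.
Proof.
move=> tT.
have res0 : (0 <= residual nu L T V K f p)%E.
  apply: integral_ge0 => s sT; apply: integral_ge0 => x _.
  by rewrite lee_fin; exact: residual_density_ge0.
case resE : (residual nu L T V K f p) res0 => [r| |] // _.
  by rewrite -EFinM; exact: KL_le_fin.
by rewrite gt0_muley ?leey// lte_fin mulr_gt0 ?invr_gt0// expR_gt0.
Qed.

End system.

Theorem theorem6 (R : realType) (d : nat) (L nu T : R)
    (V : 'rV[R]_d -> R) (K : 'rV[R]_d -> 'rV[R]_d)
    (f : R -> 'rV[R]_d -> 'rV[R]_d) (rhobar rhof : R -> 'rV[R]_d -> R)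
    (d_gt0 : (0 < d)%N) (L_gt0 : 0 < L) (nu_gt0 : 0 < nu) (T_gt0 : 0 < T)
    (V_per : torus_fun L V) (V_C2 : class_C2 V)
    (K_per : torus_fun L K) (K_Linfty : is_Linfty L K)
    (rhobar0_density : is_prob_density L (rhobar 0))
    (rhobar_sol : mckean_vlasov_solution nu L T V K rhobar)
    (f_C1 : class_C1_velocity L T f)
    (rhof_sol : continuity_solution L T f rhof)
    (rhof0 : rhof 0 = rhobar 0) :
  (ereal_sup [set KL L (rhof t) (rhobar t) | t in `[0%R, T]%classic]
   <= (nu^-1 * expR (2 * Linfty_norm L K ^+ 2 / nu * T))%:E
      * residual nu L T V K f rhof)%E.
Proof.
apply: ge_ereal_sup => _ [t /= tT <-].
exact: KL_le.
Qed.
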